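(* Let $E$ be an elliptic curve over a number field $K$, let $\ell$ be a prime, and let $n$ be the number of non-conjugate subgroups of $\mathrm{GL}_2(\mathbf{Z}/\ell\mathbf{Z})$ that arise as $G_{E^F}(\ell)$ for some quadratic twist $E^F$ of $E$. Then $n\le 3$; the case $n=3$ can occur only when $G_E(\ell)$ lies in a Borel group, and the case $n=2$ can occur only when $G_E(\ell)$ lies in either a Borel group or the normalizer of a Cartan group.
   Context: For an elliptic curve $E$ over a number field $K$, $G_E(\ell)\subseteq\mathrm{GL}_2(\mathbf{Z}/\ell\mathbf{Z})$ denotes the image of the Galois representation $\mathrm{Gal}(\overline K/K)\to\mathrm{Aut}(E[\ell])\simeq\mathrm{GL}_2(\mathbf{Z}/\ell\mathbf{Z})$, defined up to conjugacy. A quadratic twist of $E$ is an elliptic curve over $K$ that becomes isomorphic to $E$ over some quadratic extension $F/K$ (so $E$ is a quadratic twist of itself). If $E\colon y^2=f(x)$ and $F=K(\sqrt d)$, then $E^F$ denotes the quadratic twist $dy^2=f(x)$. Borel groups are the conjugates in $\mathrm{GL}_2(\mathbf{Z}/\ell\mathbf{Z})$ of the subgroup of upper triangular matrices. For $\ell$ odd, split Cartan groups are the conjugates of the group of invertible diagonal matrices, and non-split Cartan groups are the conjugates of $\left\{\begin{pmatrix} x & \varepsilon y \\ y & x \end{pmatrix}:(x,y)\ne(0,0)\right\}$, where $\varepsilon$ is a fixed non-square in $(\mathbf{Z}/\ell\mathbf{Z})^\times$; a Cartan group is either of these. For $\ell=2$ the split Cartan group is trivial and the non-split Cartan group is the subgroup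 of order $3$. *)

(* Defs.v *)
From HB Require Import structures.
From mathcomp Require Import all_boot all_order all_algebra all_fingroup all_field.
From mathcomp Require Import boolp.
Set Implicit Arguments.
Unset Strict Implicit.
Unset Printing Implicit Defensive.
Import GRing.Theory.
Local Open Scope ring_scope.

(* Weierstrass equations y^2 + a1 x y + a3 y = x^3 + a2 x^2 + a4 x + a6. *)
Record weierstrass (R : Type) := Weierstrass {
  wa1 : R; wa2 : R; wa3 : R; wa4 : R; wa6 : R }.

Definition map_weierstrass (R S : Type) (f : R -> S) (W : weierstrass R) :
    weierstrass S :=
  Weierstrass (f (wa1 W)) (f (wa2 W)) (f (wa3 W)) (f (wa4 W)) (f (wa6 W)).

Definition discriminant (R : comNzRingType) (W : weierstrass R) : R :=
  let: Weierstrass a1 a2 a3 a4 a6 := W in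
  let b2 := a1 ^+ 2 + 4%:R * a2 in
  let b4 := 2%:R * a4 + a1 * a3 in
  let b6 := a3 ^+ 2 + 4%:R * a6 in
  let b8 := a1 ^+ 2 * a6 + 4%:R * a2 * a6 - a1 * a3 * a4
            + a2 * a3 ^+ 2 - a4 ^+ 2 in
  - (b2 ^+ 2 * b8) - 8%:R * b4 ^+ 3 - 27%:R * b6 ^+ 2 + 9%:R * b2 * b4 * b6.

Record elliptic_curve (K : fieldType) := EllipticCurve {
  ec_model :> weierstrass K;
  ec_smooth : discriminant ec_model != 0 }.

(* The equation in the coordinates x', y' given by x = u^2 x' + r and
   y = u^3 y' + s u^2 x' + t. *)
Definition change_coordinates (F : fieldType) (u r s t : F)
    (W : weierstrass F) : weierstrass F :=
  let: Weierstrass a1 a2 a3 a4 a6 := W in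
  Weierstrass
    ((a1 + 2%:R * s) / u)
    ((a2 - s * a1 + 3%:R * r - s ^+ 2) / u ^+ 2)
    ((a3 + r * a1 + 2%:R * t) / u ^+ 3)
    ((a4 - s * a3 + 2%:R * r * a2 - (t + r * s) * a1
      + 3%:R * r ^+ 2 - 2%:R * s * t) / u ^+ 4)
    ((a6 + r * a4 + r ^+ 2 * a2 + r ^+ 3 - t * a3 - t ^+ 2
      - r * t * a1) / u ^+ 6).

(* The isomorphisms between elliptic curves given by Weierstrass equations are
   exactly the admissible changes of coordinates. *)
Definition ec_isomorphic (F : fieldType) (W W' : weierstrass F) : Prop :=
  exists u r s t : F, u != 0 /\ W' = change_coordinates u r s t W.

Definition quadratic_twist (K : fieldType) (E E' : elliptic_curve K) : Prop :=
  exists F : fieldExtType K,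
    \dim {:F} = 2%N /\
    ec_isomorphic (map_weierstrass (in_alg F) E) (map_weierstrass (in_alg F) E').

(* An affine pair or the point at infinity; on_curve singles out those on W. *)
Inductive point (L : Type) := Infinity | Affine of L & L.
Arguments Infinity {L}.
Arguments Affine {L} _ _.

Definition map_point (L M : Type) (f : L -> M) (P : point L) : point M :=
  if P is Affine x y then Affine (f x) (f y) else Infinity.

Definition on_curve (L : fieldType) (W : weierstrass L) (P : point L) : Prop :=
  if P is Affine x y then
    y ^+ 2 + wa1 W * x * y + wa3 W * y
    = x ^+ 3 + wa2 W * x ^+ 2 + wa4 W * x + wa6 W
  else True.

(* The chord-and-tangent law. *)
Definition add_point (L : fieldType) (W : weierstrass L) (P Q : point L) :
    point L :=
  match P, Q with
  | Infinity, _ => Q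
  | _, Infinity => P
  | Affine x1 y1, Affine x2 y2 =>
    let: Weierstrass a1 a2 a3 a4 a6 := W in
    if (x1 == x2) && (y2 == - y1 - a1 * x1 - a3) then Infinity else
    let m := if x1 == x2
             then (3%:R * x1 ^+ 2 + 2%:R * a2 * x1 + a4 - a1 * y1)
                  / (2%:R * y1 + a1 * x1 + a3)
             else (y2 - y1) / (x2 - x1) in
    let x3 := m ^+ 2 + a1 * m - a2 - x1 - x2 in
    Affine x3 (- (y1 + m * (x3 - x1)) - a1 * x3 - a3)
  end.

Definition torsion_point (L : fieldType) (W : weierstrass L) (l : nat)
    (P : point L) : Prop :=
  on_curve W P /\ iter l (add_point W P) Infinity = Infinity.

(* phi is a group isomorphism from (Z/lZ)^2 onto W[l]. *)
Definition torsion_iso (L : fieldType) (W : weierstrass L) (l : nat)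
    (phi : 'cV['F_l]_2 -> point L) : Prop :=
  [/\ forall v w, phi (v + w) = add_point W (phi v) (phi w),
      injective phi &
      forall P, torsion_point W l P <-> exists v, phi v = P].

Definition algebraic_closure (K : fieldType) (Kbar : closedFieldType)
    (iota : {rmorphism K -> Kbar}) : Prop :=
  forall z : Kbar, algebraicOver iota z.

Definition galois_aut (K : fieldType) (Kbar : closedFieldType)
    (iota : {rmorphism K -> Kbar}) (sigma : {rmorphism Kbar -> Kbar}) : Prop :=
  bijective sigma /\ forall x, sigma (iota x) = iota x.

(* G is G_E(l) for some choice of basis of E[l]; the groups with this property
   form one conjugacy class. *)
Definition galois_image (K : fieldType) (Kbar : closedFieldType)
    (iota : {rmorphism K -> Kbar}) (E : elliptic_curve K) (l : nat)
    (G : {group {'GL_2(l)}}) : Prop :=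
  exists2 phi : 'cV['F_l]_2 -> point Kbar,
    torsion_iso (map_weierstrass iota E) phi &
    forall g : {'GL_2(l)}, g \in G <->
      exists2 sigma : {rmorphism Kbar -> Kbar}, galois_aut iota sigma &
        forall v, map_point sigma (phi v) = phi (GLval g *m v).

Definition twist_image (K : fieldType) (Kbar : closedFieldType)
    (iota : {rmorphism K -> Kbar}) (E : elliptic_curve K) (l : nat)
    (H : {group {'GL_2(l)}}) : Prop :=
  exists2 E' : elliptic_curve K, quadratic_twist E E' & galois_image iota E' H.

Definition num_twist_images (K : fieldType) (Kbar : closedFieldType)
    (iota : {rmorphism K -> Kbar}) (E : elliptic_curve K) (l : nat) : nat :=
  #|[set (H :^: 'GL_2(l))%g
      | H : {group {'GL_2(l)}} & `[< twist_image iota E H >]]|.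

Section Subgroups.
Variable l : nat.
Implicit Types (A G : {set {'GL_2(l)}}) (e : 'F_l).

Definition upper_triangular : {set {'GL_2(l)}} :=
  [set g | GLval g ord_max ord0 == 0].

Definition diagonal : {set {'GL_2(l)}} := [set g | is_diag_mx (GLval g)].

(* For a non-square e the matrices [x, e y; y, x] with (x, y) <> (0, 0) are all
   invertible. *)
Definition nonsplit_form e : {set {'GL_2(l)}} :=
  [set g | (GLval g ord0 ord0 == GLval g ord_max ord_max)
           && (GLval g ord0 ord_max == e * GLval g ord_max ord0)].

Definition borel A : Prop := exists x, A = (upper_triangular :^ x)%g.

Definition split_cartan A : Prop :=
  if l == 2%N then A = 1%g else exists x, A = (diagonal :^ x)%g.

(* The choice of the non-square e is immaterial: all of them yield the same
   conjugacy class. *)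
Definition nonsplit_cartan A : Prop :=
  if l == 2%N then group_set A /\ #|A| = 3%N
  else exists e x, (forall z, z ^+ 2 != e) /\ A = (nonsplit_form e :^ x)%g.

Definition cartan A : Prop := split_cartan A \/ nonsplit_cartan A.

Definition in_borel G : Prop := exists2 B, borel B & G \subset B.

Definition in_normalizer_of_cartan G : Prop :=
  exists2 C, cartan C & G \subset 'N(C)%g.

End Subgroups.

(* Main.v *)
Require Import Defs.
From HB Require Import structures.
From mathcomp Require Import all_boot all_order all_algebra all_fingroup all_field.
From mathcomp Require Import all_solvable boolp ring.
Set Implicit Arguments.
Unset Strict Implicit.
Unset Printing Implicit Defensive.
Import GRing.Theory.
Local Open Scope ring_scope.

(** Let E' become isomorphic to E over a quadratic extension F of K, and move
    the isomorphism psi into Kbar through an embedding of F. An element sigma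
    of the Galois group sends psi either to itself or to its conjugate, and
    alpha = psi^-1 psi^conj is an automorphism of E. If h is the matrix of
    sigma on E[l] and J that of alpha, then on E'[l] (in the basis carried over
    by psi) sigma acts as h or as J h; in the first case h commutes with J, in
    the second J h J = h, because conjugation exchanges alpha and its inverse
    (twist_image_matrices). In characteristic prime to 6 the invariants c4 and
    c6 leave only J^3 = 1, J^3 = -1 and J^2 = -1 (automorphism_order). The
    first two cover the curves d y^2 = f(x); the last one does occur: if
    j(E) = 1728 and i is not in K, there is an isomorphism over K(i) that is not
    of that form. For odd l each case gives an x such that conjugation by x
    turns every h, up to sign, into the matrix on E'[l]; so the image of every
    twist, enlarged by -1, is conjugate to one fixed set Gamma = +-G_E(l)
    (pm_twist).

    What remains for l odd is group theory. A twist image either contains -1,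
    and is then conjugate to Gamma, or is conjugate to a group H without -1
    such that +-H = Gamma. Such an H meets SL_2 in a group of odd order, as -1
    is the only involution of SL_2, and this odd group is the same for all H.
    As det(H) is cyclic, H is determined by whether it contains h or -h, for one
    h whose determinant generates det(H); so there are at most two such H
    (card_twins), and n <= 3.

    If such an H exists and no line is stable under H, then H normalizes a
    Cartan group (no_line_axis). Indeed the odd group H1 = H n SL_2 is not
    trivial, as otherwise det would embed H and a line would be stable
    (SL2_trivial_line). It has no element of order l: two unipotent elements with
    different fixed lines would produce an element of trace 0 and determinant 1,
    whose square is -1, so that all would share one stable line (unipotent_line).
    Then the sum of all g in H1 vanishes, squaring permutes H1, and
    tr(g^2) = tr(g)^2 - 2 gives that tr(g) tr(g^-1) averages to 2: this is the
    trace of the projection of the 2x2 matrices onto the centralizer of H1, so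
    that this centralizer contains more than the scalars. It follows that H1
    lies in a torus, on whose trace-0 line spanned by y the group H acts by signs.

    Finally suppose n = 3, so that two non-conjugate H, H' occur, with
    generators h and -h, and suppose that no line is stable. If h y = - y h then
    conjugation by y exchanges H and H'. If h y = y h then H lies in the torus
    of y; a split torus has a stable line, and in a non-split one -1 is the only
    involution, so that H has odd order and H = H' (twins_conjugate).

    For l = 2 the trivial group is a split Cartan group, so only n <= 2 has to be
    shown. Here (J h)^2 = h^2 shows that a twist does not change the elements of
    order 3, and the conjugacy class of a subgroup of GL_2(F_2) is determined by
    its order, a divisor of 6 (card_classes_2). *)

(** * Finite groups *)

Section FinGroupFacts.
Variable gT : finGroupType.
Implicit Types (G : {group gT}) (x y : gT).
Local Open Scope group_scope.

Lemma even_order_involution G x : x \in G -> ~~ odd #[x] ->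
  exists w, [/\ w \in G, w * w = 1 & w != 1].
Proof.
move=> xG; rewrite -dvdn2 => ev; exists (x ^+ (#[x] %/ 2)).
have ow : #[x ^+ (#[x] %/ 2)] = 2.
  by rewrite orderXdiv ?dvdn_div // divnA // mulKn // order_gt0.
split; first exact: groupX.
  by rewrite -[RHS](expg_order (x ^+ (#[x] %/ 2))) ow.
by rewrite -order_gt1 ow.
Qed.

Lemma odd_order_mem G x y : x * x = 1 -> commute x y -> odd #[y] -> x * y \in G -> x \in G.
Proof.
move=> x2 cxy oy xyG; have : (x * y) ^+ #[y] \in G by apply: groupX.
rewrite expgMn // expg_order mulg1 -(odd_double_half #[y]) oy add1n.
by rewrite expgS -muln2 mulnC expgM [x ^+ 2]x2 expg1n mulg1.
Qed.

Lemma order3_pow4 x : #[x] = 3 -> x = (x * x) * (x * x).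
Proof.
move=> o3; have := expg_order x; rewrite o3 => x3.
by rewrite -[LHS]mulg1 -x3 !expgS expg0 mulg1 !mulgA.
Qed.

Lemma mem_conjV G x y : x \in G -> y \in G -> x ^ y^-1 \in G.
Proof. by move=> xG yG; rewrite groupJ ?groupV. Qed.

End FinGroupFacts.

(** * GL_2 over the prime field *)

(** With a name for the finite group, all its operations are read off a single
    structure. The instances found directly on the type of units are convertible
    to it, but comparing the two by unfolding is very slow. *)
Definition GL2 (p : nat) : finGroupType := {'GL_2(p)}.

Section GL2.
Variable p : nat.
Implicit Types g h : GL2 p.

Lemma GLvalM g h : GLval (g * h)%g = GLval g * GLval h.
Proof. by []. Qed.

Lemma GLvalMx g h : GLval (g * h)%g = GLval g *m GLval h.
Proof. by []. Qed.

Lemma GLval1 : GLval (1%g : GL2 p) = 1.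
Proof. by []. Qed.

Lemma GLvalV g : GLval g^-1%g = (GLval g)^-1.
Proof. by []. Qed.

Lemma GLvalJV g h : GLval (g ^ h^-1)%g = GLval h * (GLval g * (GLval h)^-1).
Proof. by rewrite conjgE invgK. Qed.

Lemma det_GLvalJ g h : \det (GLval (g ^ h)%g) = \det (GLval g).
Proof.
by rewrite conjgE !GLvalM !detM mulrCA -detM -GLvalM mulVg det1 mulr1.
Qed.

Lemma GLvalX g n : GLval (g ^+ n)%g = GLval g ^+ n.
Proof. by elim: n => [|n IH]; rewrite ?expg0 // expgS exprS -IH. Qed.

Lemma GLval_inj g h : GLval g = GLval h -> g = h.
Proof. exact: val_inj. Qed.

Lemma GLval_unit g : GLval g \is a GRing.unit.
Proof. exact: GL_unit. Qed.

Lemma det_GLval_neq0 g : \det (GLval g) != 0.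
Proof. exact: GL_det. Qed.

Definition GL2_of (M : 'M['F_p]_2) (Mu : M \in unitmx) : GL2 p := FinRing.unit _ Mu.

Lemma GLval_of M (Mu : M \in unitmx) : GLval (GL2_of Mu) = M.
Proof. by []. Qed.

End GL2.

(** * Weierstrass equations and coordinate changes *)

(** With explicit coefficients k1 and k2 the last hypothesis is an ideal
    membership that ring decides. *)
Lemma lincomb2_eq0 (R : pzRingType) (a b k1 k2 c : R) :
  a = 0 -> b = 0 -> c = k1 * a + k2 * b -> c = 0.
Proof. by move=> -> -> ->; rewrite !mulr0 addr0. Qed.

Record coord_change (F : Type) := CoordChange {
  cc_u : F; cc_r : F; cc_s : F; cc_t : F }.

Section CoordChange.
Variable F : fieldType.
Implicit Types (W : weierstrass F) (P Q : point F) (T : coord_change F).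

Definition model_after T W :=
  change_coordinates (cc_u T) (cc_r T) (cc_s T) (cc_t T) W.

Definition move_point T P :=
  let: CoordChange u r s t := T in
  if P is Affine x y
  then Affine ((x - r) / u ^+ 2) ((y - s * (x - r) - t) / u ^+ 3) else Infinity.

Definition cc_comp T1 T2 :=
  let: CoordChange u1 r1 s1 t1 := T1 in
  let: CoordChange u2 r2 s2 t2 := T2 in
  CoordChange (u1 * u2) (r1 + u1 ^+ 2 * r2) (s1 + u1 * s2)
    (t1 + u1 ^+ 3 * t2 + s1 * u1 ^+ 2 * r2).

Definition cc_inv T :=
  let: CoordChange u r s t := T in
  CoordChange u^-1 (- r / u ^+ 2) (- s / u) ((r * s - t) / u ^+ 3).

Lemma move_point_comp T1 T2 P : cc_u T1 != 0 -> cc_u T2 != 0 ->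
  move_point (cc_comp T1 T2) P = move_point T2 (move_point T1 P).
Proof.
case: T1 T2 P => [u1 r1 s1 t1] [u2 r2 s2 t2] [|x y] //= u1n u2n.
by congr Affine; field; rewrite u1n u2n.
Qed.

Lemma model_after_comp T1 T2 W : cc_u T1 != 0 -> cc_u T2 != 0 ->
  model_after (cc_comp T1 T2) W = model_after T2 (model_after T1 W).
Proof.
rewrite /model_after.
case: T1 T2 W => [u1 r1 s1 t1] [u2 r2 s2 t2] [a1 a2 a3 a4 a6] //= u1n u2n.
by congr Weierstrass; field; rewrite u1n u2n.
Qed.

Lemma model_afterK T W : cc_u T != 0 ->
  model_after (cc_inv T) (model_after T W) = W.
Proof.
rewrite /model_after.
case: T W => [u r s t] [a1 a2 a3 a4 a6] //= un.
by congr Weierstrass; field; rewrite ?un ?oner_eq0.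
Qed.

Lemma move_pointK T P : cc_u T != 0 -> move_point (cc_inv T) (move_point T P) = P.
Proof.
by case: T P => [u r s t] [|x y] //= un; congr Affine; field; rewrite ?un ?oner_eq0.
Qed.

Lemma move_pointVK T P : cc_u T != 0 -> move_point T (move_point (cc_inv T) P) = P.
Proof.
by case: T P => [u r s t] [|x y] //= un; congr Affine; field; rewrite ?un ?oner_eq0.
Qed.

Lemma cc_inv_neq0 T : cc_u T != 0 -> cc_u (cc_inv T) != 0.
Proof. by case: T => [u r s t] /=; rewrite invr_eq0. Qed.

Lemma cc_u_comp T1 T2 : cc_u (cc_comp T1 T2) = cc_u T1 * cc_u T2.
Proof. by case: T1 T2 => [u1 r1 s1 t1] [u2 r2 s2 t2]. Qed.

Lemma cc_comp_neq0 T1 T2 : cc_u T1 != 0 -> cc_u T2 != 0 -> cc_u (cc_comp T1 T2) != 0.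
Proof. by case: T1 T2 => [u1 r1 s1 t1] [u2 r2 s2 t2] /=; apply: mulf_neq0. Qed.

Lemma on_curve_move T W P : cc_u T != 0 ->
  on_curve W P -> on_curve (model_after T W) (move_point T P).
Proof.
rewrite /model_after /on_curve.
case: T W P => [u r s t] [a1 a2 a3 a4 a6] [|x y] //= un /eqP.
rewrite -subr_eq0 => /eqP eW; apply/eqP; rewrite -subr_eq0; apply/eqP.
rewrite -[RHS](mul0r (u ^- 6)) -{}eW; by field.
Qed.

(** The equation restricted to the chord or tangent is a cubic c in x with root
    sum x1 + x2 + x3, so c - (x - x1)(x - x2)(x - x3) is affine in x and vanishes
    at x1 and x2 (doubly at x1, in the case of a tangent); hence c(x3) = 0. *)
Lemma on_curve_add W P Q :
  on_curve W P -> on_curve W Q -> on_curve W (add_point W P Q).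
Proof.
case: W => [a1 a2 a3 a4 a6]; case: P Q => [|x1 y1] [|x2 y2] //= e1 e2.
case: ifP => //= /negbT nPQ.
set m := (if _ then _ else _).
set x3 := m ^+ 2 + a1 * m - a2 - x1 - x2.
have {e1} /eqP := e1; rewrite -subr_eq0 => /eqP e1.
have {e2} /eqP := e2; rewrite -subr_eq0 => /eqP e2.
apply/eqP; rewrite -subr_eq0; apply/eqP.
have [ex|nx] := eqVneq x1 x2.
  have ey : y2 = y1.
    move: nPQ; rewrite ex eqxx /= => ny.
    apply/eqP; rewrite -subr_eq0.
    have : (y2 - y1) * (y2 - (- y1 - a1 * x2 - a3)) = 0.
      rewrite ex in e1; rewrite -[RHS](subrr 0) -{1}e2 -e1; ring.
    by move/eqP; rewrite mulf_eq0 [X in _ || X]subr_eq0 (negPf ny) orbF.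
  subst x2 y2.
  have n0 : 2%:R * y1 + a1 * x1 + a3 != 0.
    apply: contraNneq nPQ => n0; rewrite eqxx /=.
    by rewrite -subr_eq0 -n0; apply/eqP; ring.
  have em : m * (2%:R * y1 + a1 * x1 + a3)
            - (3%:R * x1 ^+ 2 + 2%:R * a2 * x1 + a4 - a1 * y1) = 0.
    by rewrite /m eqxx; field.
  rewrite {}/x3; move: m em => m em.
  (* The first coefficient is x3 - x1. *)
  by apply: (lincomb2_eq0 (k1 := m ^+ 2 + a1 * m - a2 - x1 - x1 - x1) (k2 := 1) em e1); ring.
have n0 : x2 - x1 != 0 by rewrite subr_eq0 eq_sym.
have em : y2 = y1 + m * (x2 - x1).
  by rewrite /m (negPf nx); field.
(* Linear interpolation: (x2 - x1) c(x3) = (x2 - x3) c(x1) + (x3 - x1) c(x2). *)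
apply: (mulIf n0); rewrite mul0r.
move: e1 e2; rewrite em => e1 e2.
rewrite {}/x3; move: m {em} e2 => m e2.
have {}e2 : (y1 + m * (x2 - x1)) ^+ 2 + a1 * x2 * (y1 + m * (x2 - x1)) + a3 * (y1 + m * (x2 - x1)) -
     (x2 ^+ 3 + a2 * x2 ^+ 2 + a4 * x2 + a6) = 0 by [].
by apply: (lincomb2_eq0 (k1 := x2 - (m ^+ 2 + a1 * m - a2 - x1 - x2))
  (k2 := (m ^+ 2 + a1 * m - a2 - x1 - x2) - x1) e1 e2); ring.
Qed.

(** Both points must be on the curve: for equal x-coordinates the group law
    uses the tangent at P, and if this is vertical its quotient by 0 has no
    geometric meaning. On the curve that only happens when Q = -P. *)
Lemma move_point_add T W P Q : cc_u T != 0 -> on_curve W P -> on_curve W Q ->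
  move_point T (add_point W P Q)
  = add_point (model_after T W) (move_point T P) (move_point T Q).
Proof.
rewrite /model_after.
case: T W => [u r s t] [a1 a2 a3 a4 a6].
case: P Q => [|x1 y1] [|x2 y2] //= un e1 e2.
have u2n : u ^+ 2 != 0 by rewrite expf_neq0.
have u3n : u ^+ 3 != 0 by rewrite expf_neq0.
have xE : ((x1 - r) / u ^+ 2 == (x2 - r) / u ^+ 2) = (x1 == x2).
  by rewrite (inj_eq (mulIf _)) ?invr_eq0 // (inj_eq (addIr _)).
rewrite xE.
have [ex|nx] := eqVneq x1 x2 => /=; last first.
  have n0 : x2 - x1 != 0 by rewrite subr_eq0 eq_sym.
  have n1 : (x2 - r) - (x1 - r) != 0.
    by rewrite (_ : _ - _ = x2 - x1) //; ring.
  by congr Affine; field; rewrite ?un ?n0 ?n1.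
subst x2.
have yE : ((y2 - s * (x1 - r) - t) / u ^+ 3 ==
   - ((y1 - s * (x1 - r) - t) / u ^+ 3) - (a1 + 2%:R * s) / u * ((x1 - r) / u ^+ 2) -
   (a3 + r * a1 + 2%:R * t) / u ^+ 3) = (y2 == - y1 - a1 * x1 - a3).
  rewrite -subr_eq0 -[RHS]subr_eq0.
  have -> : (y2 - s * (x1 - r) - t) / u ^+ 3 -
   (- ((y1 - s * (x1 - r) - t) / u ^+ 3) - (a1 + 2%:R * s) / u * ((x1 - r) / u ^+ 2) -
   (a3 + r * a1 + 2%:R * t) / u ^+ 3) = (y2 - (- y1 - a1 * x1 - a3)) / u ^+ 3.
    by field.
  by rewrite mulf_eq0 invr_eq0 (negPf u3n) orbF.
rewrite yE; case: ifP => //= /negbT ny.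
have ey : y2 = y1.
  apply/eqP; rewrite -subr_eq0.
  have : (y2 - y1) * (y2 - (- y1 - a1 * x1 - a3)) = 0.
    move/eqP: e1; rewrite -subr_eq0 => /eqP e1.
    move/eqP: e2; rewrite -subr_eq0 => /eqP e2.
    rewrite -[RHS](subrr 0) -{1}e2 -e1; ring.
  by move/eqP; rewrite mulf_eq0 [X in _ || X]subr_eq0 (negPf ny) orbF.
subst y2.
have n0 : 2%:R * y1 + a1 * x1 + a3 != 0.
  apply: contraNneq ny => n0.
  by rewrite -subr_eq0 -n0; apply/eqP; ring.
have n1 : 2%:R * (y1 - s * (x1 - r) - t) + (a1 + 2%:R * s) * (x1 - r) + (a3 + r * a1 + 2%:R * t) != 0.
  by rewrite (_ : _ + _ = 2%:R * y1 + a1 * x1 + a3) //; ring.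
congr Affine; field; rewrite ?un ?n0 ?n1 //=.
Qed.

Definition c4_inv W : F :=
  let: Weierstrass a1 a2 a3 a4 a6 := W in
  (a1 ^+ 2 + 4%:R * a2) ^+ 2 - 24%:R * (2%:R * a4 + a1 * a3).

Definition c6_inv W : F :=
  let: Weierstrass a1 a2 a3 a4 a6 := W in
  let b2 := a1 ^+ 2 + 4%:R * a2 in
  let b4 := 2%:R * a4 + a1 * a3 in
  let b6 := a3 ^+ 2 + 4%:R * a6 in
  - b2 ^+ 3 + 36%:R * b2 * b4 - 216%:R * b6.

Lemma discriminantE W : 1728%:R * discriminant W = c4_inv W ^+ 3 - c6_inv W ^+ 2.
Proof. case: W => [a1 a2 a3 a4 a6] /=; ring. Qed.

Lemma c4_inv_model T W : cc_u T != 0 ->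
  c4_inv W = cc_u T ^+ 4 * c4_inv (model_after T W).
Proof.
by rewrite /model_after; case: T W => [u r s t] [a1 a2 a3 a4 a6] /= un; field.
Qed.

Lemma c6_inv_model T W : cc_u T != 0 ->
  c6_inv W = cc_u T ^+ 6 * c6_inv (model_after T W).
Proof.
by rewrite /model_after; case: T W => [u r s t] [a1 a2 a3 a4 a6] /= un; field.
Qed.

Definition opp_point W P :=
  if P is Affine x y then Affine x (- y - wa1 W * x - wa3 W) else Infinity.

Hypotheses (n2 : 2%:R != 0 :> F) (n3 : 3%:R != 0 :> F).

Lemma automorphism_u1 T W P :
  model_after T W = W -> cc_u T = 1 -> move_point T P = P.
Proof.
case: T W P => [u r s t] [a1 a2 a3 a4 a6] [|x y] //= [e1 e2 e3 _ _] u1.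
rewrite {}u1 ?expr1n ?divr1 in e1 e2 e3 *.
have s0 : s = 0.
  by apply: (mulfI n2); rewrite mulr0; apply: (addrI a1); rewrite e1 addr0.
rewrite {}s0 in e2 *.
have r0 : r = 0.
  apply: (mulfI n3); rewrite mulr0; apply: (addrI a2); rewrite -{2}e2; ring.
rewrite {}r0 in e3 *.
have t0 : t = 0.
  apply: (mulfI n2); rewrite mulr0; apply: (addrI a3); rewrite -{2}e3; ring.
by rewrite t0; congr Affine; ring.
Qed.

Lemma automorphism_uN1 T W P :
  model_after T W = W -> cc_u T = -1 -> move_point T P = opp_point W P.
Proof.
case: T W P => [u r s t] [a1 a2 a3 a4 a6] [|x y] //= [e1 e2 e3 _ _] u1.
have i1 : (-1 : F)^-1 = -1 by rewrite invrN invr1.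
have i2 : (-1 : F) ^+ 2 = 1 by rewrite sqrrN expr1n.
have i3 : (-1 : F) ^+ 3 = -1 by rewrite exprS i2 mulr1.
rewrite {}u1 ?i2 ?i3 ?i1 ?divr1 ?mulrN1 in e1 e2 e3 *.
have s0 : s = - a1.
  apply: (mulfI n2); apply: (addrI a1); rewrite -[LHS]opprK e1; ring.
rewrite {}s0 in e2 *.
have r0 : r = 0.
  apply: (mulfI n3); rewrite mulr0; apply: (addrI a2); rewrite -{2}e2; ring.
rewrite {}r0 in e3 *.
have t0 : t = - a3.
  apply: (mulfI n2); apply: (addrI a3).
  transitivity (- a3); last by ring.
  rewrite -[in RHS]e3; ring.
by rewrite t0; congr Affine; ring.
Qed.

(** An automorphism scales c4 by u^4 and c6 by u^6, and one of c4, c6 is nonzero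
    as 1728 Delta = c4^3 - c6^2. So u^2 = -1 or u^3 = 1 or u^3 = -1, and u = 1
    and u = -1 are only attained by the identity and by P |-> -P. *)
Lemma automorphism_order T W : discriminant W != 0 -> cc_u T != 0 ->
    model_after T W = W ->
  [\/ forall P, move_point T (move_point T P) = opp_point W P,
      forall P, move_point T (move_point T (move_point T P)) = P |
      forall P, move_point T (move_point T (move_point T P)) = opp_point W P].
Proof.
move=> dW un eW.
have T2n := cc_comp_neq0 un un; set T2 := cc_comp T T in T2n.
have T3n := cc_comp_neq0 T2n un; set T3 := cc_comp T2 T in T3n.
have eW2 : model_after T2 W = W by rewrite /T2 model_after_comp ?eW.
have eW3 : model_after T3 W = W by rewrite /T3 model_after_comp ?eW2 ?eW.
have E2 P : move_point T (move_point T P) = move_point T2 P.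
  by rewrite /T2 move_point_comp.
have E3 P : move_point T (move_point T (move_point T P)) = move_point T3 P.
  by rewrite E2 /T3 !move_point_comp.
have uE2 : cc_u T2 = cc_u T ^+ 2 by rewrite cc_u_comp.
have uE3 : cc_u T3 = cc_u T ^+ 3 by rewrite cc_u_comp uE2 -exprSr.
have sgn (a : F) : a ^+ 2 = 1 -> a = 1 \/ a = -1.
  by move/eqP; rewrite sqrf_eq1 => /orP[] /eqP; [left | right].
have cubes : cc_u T3 = 1 \/ cc_u T3 = -1 ->
    (forall P, move_point T (move_point T (move_point T P)) = P) \/
    (forall P, move_point T (move_point T (move_point T P)) = opp_point W P).
  by case=> u3; [left | right] => P; rewrite E3;
    [apply: automorphism_u1 eW3 u3 | apply: automorphism_uN1 eW3 u3].
have [c40 | c4n] := eqVneq (c4_inv W) 0.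
  have c6n : c6_inv W != 0.
    apply: contraNneq dW => c60.
    have : 1728%:R * discriminant W = 0 by rewrite discriminantE c40 c60; ring.
    have -> : 1728%:R = 2%:R ^+ 6 * 3%:R ^+ 3 :> F by ring.
    have n1728 : 2%:R ^+ 6 * 3%:R ^+ 3 != 0 :> F by rewrite mulf_neq0 ?expf_neq0.
    by move/eqP; rewrite mulf_eq0 (negPf n1728).
  have u6 : cc_u T ^+ 6 = 1.
    by apply: (mulIf c6n); rewrite mul1r -{1}eW -c6_inv_model.
  have /cubes[? | ?] : cc_u T3 = 1 \/ cc_u T3 = -1.
    by apply: sgn; rewrite uE3 -exprM.
  - exact: Or32.
  exact: Or33.
have u4 : cc_u T ^+ 4 = 1.
  by apply: (mulIf c4n); rewrite mul1r -{1}eW -c4_inv_model.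
have /sgn[u2|u2] : cc_u T2 ^+ 2 = 1 by rewrite uE2 -exprM.
  have /cubes[? | ?] : cc_u T3 = 1 \/ cc_u T3 = -1.
    by apply: sgn; rewrite uE3 exprAC -uE2 u2 expr1n.
  - exact: Or32.
  exact: Or33.
by apply: Or31 => P; rewrite E2; apply: automorphism_uN1 eW2 u2.
Qed.

End CoordChange.

(** * Embeddings of a quadratic extension and the Galois action *)
Section Embeddings.
Variables (K : fieldType) (Kbar : closedFieldType) (iota : {rmorphism K -> Kbar}).

(** Write F = K + K b with b^2 = c0 + c1 b. The two embeddings send b to the
    two roots of X^2 - c1 X - c0, and sigma permutes these roots. They coincide
    if the extension is inseparable, which does no harm. *)
Lemma quadratic_embeddings (F : fieldExtType K) : \dim {:F} = 2%N ->
  exists f fbar : {rmorphism F -> Kbar},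
  [/\ forall x, f (in_alg F x) = iota x, forall x, fbar (in_alg F x) = iota x &
      forall sigma : {rmorphism Kbar -> Kbar}, (forall x, sigma (iota x) = iota x) ->
        (forall x, sigma (f x) = f x /\ sigma (fbar x) = fbar x) \/
        (forall x, sigma (f x) = fbar x /\ sigma (fbar x) = f x)].
Proof.
move=> dimF.
have /subvPn[b _ bn] : ~~ ({:F} <= 1%VS)%VS.
  by apply/negP => /dimvS; rewrite dimF dimv1.
pose X := [tuple b; (1 : F)].
have frX : free X.
  by rewrite /X free_cons seq1_free oner_neq0 andbT span_seq1.
have bX : basis_of {:F} X by rewrite basisEfree frX subvf dimF.
pose c0 := coord X 1; pose c1 := coord X 0.
have cE x : x = c0 x *: 1 + c1 x *: b.
  rewrite {1}(coord_basis bX (memvf x)) big_ord_recl big_ord1 addrC.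
  by congr (_ *: _ + _ *: _); congr (coord X _ x); apply: val_inj.
have c01 : c0 1 = 1 := coord_free 1 1 frX.
have c0b : c0 b = 0 := coord_free 0 1 frX.
have c11 : c1 1 = 0 := coord_free 1 0 frX.
have c1b : c1 b = 1 := coord_free 0 0 frX.
have c0E a a' : c0 (a *: 1 + a' *: b) = a.
  by rewrite /c0 linearD !linearZ /= -/c0 c01 c0b mulr1 mulr0 addr0.
have c1E a a' : c1 (a *: 1 + a' *: b) = a'.
  by rewrite /c1 linearD !linearZ /= -/c1 c11 c1b mulr1 mulr0 add0r.
pose p := iota (c0 (b * b)); pose q := iota (c1 (b * b)).
pose ev (beta : Kbar) (x : F) := iota (c0 x) + iota (c1 x) * beta.
have ev_rmorph beta : beta ^+ 2 = p + q * beta ->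
    exists f : {rmorphism F -> Kbar}, f =1 ev beta.
  move=> eb; have eb0 : beta ^+ 2 - (p + q * beta) = 0 by rewrite eb subrr.
  have evB : zmod_morphism (ev beta).
    by move=> x y; rewrite /ev /c0 /c1 !linearB !rmorphB /= mulrBl; ring.
  have ev1 : ev beta 1 = 1.
    have e1 : (1 : F) = 1 *: 1 + 0 *: b by rewrite scale1r scale0r addr0.
    by rewrite /ev e1 c0E c1E rmorph1 rmorph0 mul0r addr0.
  have evM : {morph ev beta : x y / x * y}.
    move=> x y.
    have -> : x * y = (c0 x * c0 y + c1 x * c1 y * c0 (b * b)) *: 1
        + (c0 x * c1 y + c1 x * c0 y + c1 x * c1 y * c1 (b * b)) *: b.
      rewrite [in LHS](cE x) [in LHS](cE y).
      rewrite mulrDl !mulrDr -!scalerAl -!scalerAr !mul1r !mulr1 [b * b in LHS]cE.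
      rewrite !scalerDr !scalerA !scalerDl; set u := 1%R; ring.
    rewrite /ev c0E c1E !rmorphD !rmorphM /= -/p -/q.
    by apply/eqP; rewrite -subr_eq0; apply/eqP; apply: (lincomb2_eq0
      (k1 := - iota (c1 x) * iota (c1 y)) (k2 := 0) eb0 (erefl 0)); ring.
  have evMm : monoid_morphism (ev beta) by split.
  pose f : {rmorphism F -> Kbar} := HB.pack (ev beta)
    (GRing.isZmodMorphism.Build _ _ _ evB) (GRing.isMonoidMorphism.Build _ _ _ evMm).
  by exists f.
have [beta eb] : exists beta, beta ^+ 2 = p + q * beta.
  have [//|beta eb] := @solve_monicpoly Kbar 2 (nth 0 [:: p; q]).
  by exists beta; rewrite eb !big_ord_recl big_ord0 /= expr0 mulr1 expr1 addr0.
have eb' : (q - beta) ^+ 2 = p + q * (q - beta) by ring: eb.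
have [f fE] := ev_rmorph _ eb; have [fbar fbarE] := ev_rmorph _ eb'.
have evK z x : ev z (in_alg F x) = iota x.
  have ex : in_alg F x = x *: 1 + 0 *: b by rewrite scale0r addr0.
  by rewrite /ev ex c0E c1E rmorph0 mul0r addr0.
exists f, fbar; split=> [x|x|sigma fixK]; rewrite ?fE ?fbarE ?evK //.
have sev z x : sigma (ev z x) = ev (sigma z) x by rewrite /ev rmorphD rmorphM !fixK.
have sbar : sigma (q - beta) = q - sigma beta by rewrite rmorphB fixK.
have /eqP : (sigma beta - beta) * (sigma beta - (q - beta)) = 0.
  have : sigma beta ^+ 2 = p + q * sigma beta.
    by rewrite -rmorphXn eb rmorphD rmorphM !fixK.
  by move=> eb2; ring: eb eb2.
rewrite mulf_eq0 !subr_eq0 => /orP[] /eqP sb; [left | right] => x;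
  rewrite !fE !fbarE !sev sbar sb //; split=> //; congr ev; ring.
Qed.

End Embeddings.

Section Maps.
Variables (F L : fieldType) (f : {rmorphism F -> L}).

Definition map_cc (T : coord_change F) : coord_change L :=
  CoordChange (f (cc_u T)) (f (cc_r T)) (f (cc_s T)) (f (cc_t T)).

Lemma map_model T W :
  map_weierstrass f (model_after T W) = model_after (map_cc T) (map_weierstrass f W).
Proof.
case: T W => [u r s t] [a1 a2 a3 a4 a6]; rewrite /map_weierstrass /model_after /=.
by congr Weierstrass;
  rewrite !(rmorph_nat, rmorphXn, fmorphV, rmorphB, rmorphM, rmorphD).
Qed.

Lemma map_move_point T P :
  map_point f (move_point T P) = move_point (map_cc T) (map_point f P).
Proof.
case: T P => [u r s t] [|x y] //=.
by congr Affine; rewrite !(rmorphXn, fmorphV, rmorphB, rmorphM).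
Qed.

Lemma map_add_point W P Q :
  map_point f (add_point W P Q)
  = add_point (map_weierstrass f W) (map_point f P) (map_point f Q).
Proof.
case: W P Q => [a1 a2 a3 a4 a6] [|x1 y1] [|x2 y2] //=.
rewrite -rmorphN -!rmorphM -!rmorphB !(inj_eq (fmorph_inj f)).
case: ifP => // _.
have [_|_] := eqVneq x1 x2; congr Affine;
  by rewrite !(rmorph_nat, rmorphXn, fmorphV, rmorphB, rmorphN, rmorphM, rmorphD).
Qed.

Lemma map_on_curve W P : on_curve W P -> on_curve (map_weierstrass f W) (map_point f P).
Proof.
by case: W P => [a1 a2 a3 a4 a6] [|x1 y1] //= H;
  rewrite -!rmorphXn -!rmorphM -!rmorphD H.
Qed.

Lemma map_discriminant W : discriminant (map_weierstrass f W) = f (discriminant W).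
Proof.
case: W => [a1 a2 a3 a4 a6] /=.
by rewrite !(rmorph_nat, rmorphXn, rmorphB, rmorphN, rmorphM, rmorphD).
Qed.

Lemma map_point_inj : injective (map_point f).
Proof. by move=> [|x y] [|x' y'] //= [/fmorph_inj-> /fmorph_inj->]. Qed.

End Maps.

(** * Torsion points and matrices *)

(** Over a prime field additivity implies linearity. *)
Lemma additive_GL (p : nat) (pr : prime p) (w : 'cV['F_p]_2 -> 'cV['F_p]_2) :
  (forall u v, w (u + v) = w u + w v) -> injective w ->
  exists g : GL2 p, forall v, w v = GLval g *m v.
Proof.
move=> wD wI.
have w0 : w 0 = 0 by apply: (addrI (w 0)); rewrite -wD !addr0.
have wMn v n : w (v *+ n) = w v *+ n.
  by elim: n => [|n IH]; rewrite ?mulr0n ?w0 // !mulrS wD IH.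
have wZ (a : 'F_p) v : w (a *: v) = a *: w v.
  by rewrite -[a]natr_Zp !scaler_nat wMn.
have wsum (I : finType) (G : I -> 'cV['F_p]_2) : w (\sum_i G i) = \sum_i w (G i).
  by apply: (big_morph w wD w0).
pose A : 'M['F_p]_2 := \matrix_(i, j) w (delta_mx j 0) i 0.
have wA v : w v = A *m v.
  rewrite [in LHS](matrix_sum_delta v) wsum; apply/matrixP => i k; rewrite ord1.
  rewrite summxE mxE; apply: eq_bigr => j _.
  by rewrite big_ord1 wZ !mxE mulrC.
have Au : A \in unitmx.
  rewrite -unitmx_tr -row_free_unit -kermx_eq0; apply/eqP/row_matrixP => i.
  apply: trmx_inj; rewrite row0 trmx0; apply: wI; rewrite w0 wA.
  by apply: trmx_inj; rewrite trmx_mul trmxK -row_mul mulmx_ker row0 trmx0.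
by exists (GL2_of Au).
Qed.

Section CurveHom.
Variable L : fieldType.
Implicit Types (W : weierstrass L) (f : point L -> point L).

(** Galois elements, coordinate changes and their composites all have these
    properties, and only these matter for the action on torsion points. *)
Definition curve_hom W W' f :=
  [/\ f Infinity = Infinity, injective f,
      forall P, on_curve W P -> on_curve W' (f P) &
      forall P Q, on_curve W P -> on_curve W Q ->
        f (add_point W P Q) = add_point W' (f P) (f Q)].

Lemma curve_hom_id W : curve_hom W W id.
Proof. by split. Qed.

Lemma curve_hom_move T W : cc_u T != 0 ->
  curve_hom W (model_after T W) (move_point T).
Proof.
move=> un; split.
- by case: T un.
- by apply: can_inj (move_point (cc_inv T)) _ => P; apply: move_pointK.
- by move=> P; apply: on_curve_move.
by move=> P Q; apply: move_point_add.
Qed.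

Lemma curve_hom_map (s : {rmorphism L -> L}) W :
  map_weierstrass s W = W -> curve_hom W W (map_point s).
Proof.
move=> sW; split=> //; first exact: map_point_inj.
- by move=> P /(map_on_curve s); rewrite sW.
by move=> P Q _ _; rewrite map_add_point sW.
Qed.

Lemma iter_add_on_curve W P n : on_curve W P ->
  on_curve W (iter n (add_point W P) Infinity).
Proof. by move=> cP; elim: n => //= n IH; apply: on_curve_add. Qed.

(** The multiples of P stay on the curve, where f is additive. *)
Lemma curve_hom_torsion W W' f l P : curve_hom W W' f ->
  torsion_point W l P -> torsion_point W' l (f P).
Proof.
case=> f0 _ fC fD [cP tP]; split; first exact: fC.
suff itE n : iter n (add_point W' (f P)) Infinity = f (iter n (add_point W P) Infinity).
  by rewrite itE tP.
elim: n => [|n IH] //=; rewrite IH fD //; exact: iter_add_on_curve.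
Qed.

Variables (l : nat) (l_pr : prime l).
Implicit Type phi : 'cV['F_l]_2 -> point L.

Lemma torsion_iso_point W phi v : torsion_iso W phi -> torsion_point W l (phi v).
Proof. by case=> _ _ sphi; apply/sphi; exists v. Qed.

Lemma torsion_iso_curve W phi v : torsion_iso W phi -> on_curve W (phi v).
Proof. by case/(torsion_iso_point v). Qed.

(** Infinity is a torsion point, hence some phi v, and
    phi 0 + phi v = phi v leaves no other value for phi 0. *)
Lemma torsion_iso0 W phi : torsion_iso W phi -> phi 0 = Infinity.
Proof.
case=> phiD _ sphi.
have [v phiv] : exists v, phi v = Infinity.
  by apply/sphi; split=> //; elim: (l) => //= n ->.
by have := phiD 0 v; rewrite add0r phiv; case: (phi 0).
Qed.

Lemma torsion_isoN W phi v : torsion_iso W phi -> phi (- v) = opp_point W (phi v).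
Proof.
move=> tphi; case: (tphi) => phiD _ _.
have := phiD v (- v); rewrite subrr (torsion_iso0 tphi).
case: (W) (phi v) (phi (- v)) => [a1 a2 a3 a4 a6] [|x y] [|x' y'] //=.
by case: ifP => // /andP[/eqP-> /eqP->].
Qed.

(** Used for Galois elements, for automorphisms, and with f the identity for
    a change of basis. *)
Lemma curve_hom_matrix W W' phi phi' f :
  torsion_iso W phi -> torsion_iso W' phi' -> curve_hom W W' f ->
  exists g : GL2 l, forall v, f (phi v) = phi' (GLval g *m v).
Proof.
move=> tphi tphi' hf; case: (hf) => _ fI _ fD.
case: (tphi) (tphi') => phiD phiI _ [phiD' phiI' sphi'].
have /choice[w wE] : forall v, exists w, phi' w = f (phi v).
  by move=> v; apply/sphi'; apply: curve_hom_torsion hf _; apply: torsion_iso_point.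
have [||g gE] := @additive_GL l l_pr w.
- move=> u v; apply: phiI'.
  by rewrite phiD' !wE phiD fD //; apply: torsion_iso_curve tphi.
- by move=> u v /(congr1 phi'); rewrite !wE => /fI /phiI.
by exists g => v; rewrite -gE wE.
Qed.

Lemma torsion_iso_pull W W' phi' f f' : torsion_iso W' phi' ->
  curve_hom W W' f -> curve_hom W' W f' -> cancel f f' ->
  torsion_iso W (f' \o phi').
Proof.
move=> tphi' hf hf' fK; case: (tphi') (hf') => phiD phiI sphi [_ fI' _ fD']; split.
- by move=> v w /=; rewrite phiD fD' //; apply: torsion_iso_curve tphi'.
- exact: inj_comp.
move=> P; split=> [tP | [v <-]].
  have /sphi[v vE] := curve_hom_torsion hf tP.
  by exists v; rewrite /= vE fK.
by apply: curve_hom_torsion hf' _; apply: torsion_iso_point.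
Qed.

End CurveHom.

Section GaloisAction.
Variables (K : fieldType) (Kbar : closedFieldType) (iota : {rmorphism K -> Kbar}).
Variables (l : nat) (l_pr : prime l).
Implicit Types (phi : 'cV['F_l]_2 -> point Kbar) (g h J : GL2 l).
Implicit Types (sigma tau : {rmorphism Kbar -> Kbar}).

Lemma GL_eq g h : (forall v : 'cV['F_l]_2, GLval g *m v = GLval h *m v) -> g = h.
Proof.
move=> gh; apply: val_inj; apply/matrixP => i j.
by have /matrixP/(_ i 0) := gh (delta_mx j 0); rewrite -!colE !mxE.
Qed.

Definition minus1 : GL2 l := FinRing.unit _ (unitrN1 'M['F_l]_2).

Definition acts_as phi sigma g :=
  forall v, map_point sigma (phi v) = phi (GLval g *m v).

Section Fixed.
Variables (W : weierstrass Kbar) (phi : 'cV['F_l]_2 -> point Kbar).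
Hypothesis tphi : torsion_iso W phi.

Lemma phi_GL_inj g h :
  (forall v, phi (GLval g *m v) = phi (GLval h *m v)) -> g = h.
Proof. by case: tphi => _ phiI _ gh; apply: GL_eq => v; apply: phiI. Qed.

Lemma acts_as_mul sigma tau g h :
  acts_as phi sigma g -> acts_as phi tau h -> acts_as phi (sigma \o tau) (g * h)%g.
Proof.
move=> gP hP v; rewrite GLvalMx -mulmxA -gP -hP.
by case: (phi v).
Qed.

Lemma acts_as_id : acts_as phi idfun 1%g.
Proof. by move=> v; rewrite GLval1 mul1mx; case: (phi v). Qed.

End Fixed.

Lemma galois_aut_comp sigma tau :
  galois_aut iota sigma -> galois_aut iota tau -> galois_aut iota (sigma \o tau).
Proof.
by move=> [bs fs] [bt ft]; split=> [|x /=]; [exact: bij_comp | rewrite ft fs].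
Qed.

Lemma galois_aut_id : galois_aut iota idfun.
Proof. by split=> //; exists id. Qed.

Lemma galois_map_model sigma (W : weierstrass K) : galois_aut iota sigma ->
  map_weierstrass sigma (map_weierstrass iota W) = map_weierstrass iota W.
Proof.
by case=> _ fs; case: W => [a1 a2 a3 a4 a6]; rewrite /map_weierstrass /= !fs.
Qed.

Lemma acts_as_exists E phi sigma :
    torsion_iso (map_weierstrass iota E) phi -> galois_aut iota sigma ->
  exists g, acts_as phi sigma g.
Proof.
move=> tphi /(galois_map_model E)/curve_hom_map; exact: curve_hom_matrix.
Qed.

Lemma galois_image_exists (E : elliptic_curve K) phi :
    torsion_iso (map_weierstrass iota E) phi ->
  exists H : {group GL2 l}, forall g,
    g \in H <-> exists2 sigma, galois_aut iota sigma & acts_as phi sigma g.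
Proof.
move=> tphi.
pose H := [set g | `[< exists2 sigma, galois_aut iota sigma & acts_as phi sigma g >]].
have gH : group_set H.
  apply/group_setP; split.
    rewrite inE; apply/asboolP.
    by exists idfun; [exact: galois_aut_id | exact: acts_as_id].
  move=> g h; rewrite !inE => /asboolP[s gs sg] /asboolP[t gt th].
  apply/asboolP; exists (s \o t : {rmorphism Kbar -> Kbar}).
    exact: galois_aut_comp.
  exact: acts_as_mul.
by exists (Group gH) => g; rewrite inE; split=> /asboolP.
Qed.

Lemma galois_image_conj (E : elliptic_curve K) (G H : {group GL2 l}) :
  galois_image iota E G -> galois_image iota E H ->
  exists x, (G :=: H :^ x)%g.
Proof.
case=> phi tphi GE [phi2 tphi2 HE].
have [x xE] := curve_hom_matrix l_pr tphi tphi2 (curve_hom_id _).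
have phiE v : phi v = phi2 (GLval x *m v) := xE v.
exists x; apply/setP => g; rewrite mem_conjg conjgE invgK.
have act s : acts_as phi s g <-> acts_as phi2 s (x * (g * x^-1))%g.
  split=> ag v.
    have := ag (GLval x^-1 *m v); rewrite !phiE !mulmxA -!GLvalMx.
    by rewrite -mulgA mulgV GLval1 mul1mx.
  by rewrite !phiE ag !mulmxA -!GLvalMx -!mulgA mulVg mulg1.
apply/idP/idP.
  move/GE => [s gs ag]; apply/HE; exists s => //; exact/act.
by move/HE => [s gs ag]; apply/GE; exists s => //; exact/act.
Qed.

(** The two possible relations between the matrices h and g of a Galois element
    on E[l] and on E'[l]: it fixes the isomorphism from E to E', or it composes
    it with the automorphism of matrix J, in which case it inverts J. *)
Definition twisted_by J h g :=
  (g = h /\ (h * J = J * h)%g) \/ (g = (J * h)%g /\ (J * h * J = h)%g).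

(** E[l] gets the basis that corresponds to the given one of E'[l]. *)
Lemma twist_image_matrices (E : elliptic_curve K) (H' : {group GL2 l}) :
    2%:R != 0 :> Kbar -> 3%:R != 0 :> Kbar -> twist_image iota E H' ->
  exists (H : {group GL2 l}) J,
  [/\ galois_image iota E H,
      [\/ (J * J = minus1)%g, (J * (J * J) = 1)%g | (J * (J * J) = minus1)%g],
      forall g, g \in H' -> exists2 h, h \in H & twisted_by J h g &
      forall h, h \in H -> exists2 g, g \in H' & twisted_by J h g].
Proof.
move=> n2 n3 [E' [F [dimF [u [r [s [t [un eE']]]]]]] [phi' tphi' H'E]].
have [f [fbar [fK fbarK fgal]]] := quadratic_embeddings iota dimF.
pose T0 := CoordChange u r s t.
pose T := map_cc f T0; pose Tbar := map_cc fbar T0.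
set W := map_weierstrass iota E in tphi' *.
set W' := map_weierstrass iota E' in tphi'.
have mapK (e : {rmorphism F -> Kbar}) (V : weierstrass K) :
    (forall x, e (in_alg F x) = iota x) ->
    map_weierstrass e (map_weierstrass (in_alg F) V) = map_weierstrass iota V.
  by move=> eK; case: V => [? ? ? ? ?]; rewrite /map_weierstrass /= !eK.
have eT : model_after T W = W'.
  by rewrite /W' -(mapK f) // eE' -/(model_after T0 _) map_model mapK.
have eTbar : model_after Tbar W = W'.
  by rewrite /W' -(mapK fbar) // eE' -/(model_after T0 _) map_model mapK.
have Tn : cc_u T != 0 by rewrite fmorph_eq0.
have Tbarn : cc_u Tbar != 0 by rewrite fmorph_eq0.
have hT := curve_hom_move W Tn; rewrite eT in hT.
have hTV := curve_hom_move W' (cc_inv_neq0 Tn).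
rewrite -[X in model_after _ X]eT model_afterK // in hTV.
pose phi := move_point (cc_inv T) \o phi'.
have tphi : torsion_iso W phi.
  by apply: torsion_iso_pull tphi' hT hTV _ => P; apply: move_pointK.
have phi'E v : phi' v = move_point T (phi v) by rewrite -[LHS](move_pointVK _ Tn).
have [H HE] := galois_image_exists tphi.
(* alpha, the automorphism of E by which the two conjugate isomorphisms differ *)
pose A := cc_comp Tbar (cc_inv T).
have An : cc_u A != 0 by apply: cc_comp_neq0 (cc_inv_neq0 Tn).
have eA : model_after A W = W.
  by rewrite model_after_comp ?cc_inv_neq0 // eTbar -eT model_afterK.
have hA := curve_hom_move W An; rewrite eA in hA.
have [J JE] := curve_hom_matrix l_pr tphi tphi hA.
have TA P : move_point T (move_point A P) = move_point Tbar P.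
  by rewrite /A move_point_comp ?cc_inv_neq0 // move_pointVK.
have T_inj : injective (move_point T) by case: hT.
have cases sigma h : galois_aut iota sigma -> acts_as phi sigma h ->
    exists2 g, acts_as phi' sigma g & twisted_by J h g.
  move=> gs hP; case: (gs) => _ /fgal[] sf.
    have fixT P : map_point sigma (move_point T P) = move_point T (map_point sigma P).
      by rewrite map_move_point /map_cc /= !(proj1 (sf _)).
    have fixTbar P :
        map_point sigma (move_point Tbar P) = move_point Tbar (map_point sigma P).
      by rewrite map_move_point /map_cc /= !(proj2 (sf _)).
    exists h; first by move=> v; rewrite !phi'E fixT hP.
    left; split=> //; apply: (phi_GL_inj tphi) => v.
    rewrite !GLvalMx -!mulmxA -hP -!JE -hP.
    by apply: T_inj; rewrite -fixT !TA fixTbar.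
  have swapT P : map_point sigma (move_point T P) = move_point Tbar (map_point sigma P).
    by rewrite map_move_point /map_cc /= !(proj1 (sf _)).
  have swapTbar P :
      map_point sigma (move_point Tbar P) = move_point T (map_point sigma P).
    by rewrite map_move_point /map_cc /= !(proj2 (sf _)).
  exists (J * h)%g.
    by move=> v; rewrite !phi'E swapT hP GLvalMx -mulmxA -JE TA.
  right; split=> //; apply: (phi_GL_inj tphi) => v.
  rewrite !GLvalMx -!mulmxA -JE -hP -JE -hP.
  by apply: T_inj; rewrite TA -swapT TA swapTbar.
have powJ v : move_point A (move_point A (phi v)) = phi (GLval (J * J)%g *m v).
  by rewrite !JE mulmxA.
have powJ3 v : move_point A (move_point A (move_point A (phi v)))
    = phi (GLval (J * (J * J))%g *m v).
  by rewrite powJ JE mulmxA.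
have oppJ v : opp_point W (phi v) = phi (GLval minus1 *m v).
  by rewrite -(torsion_isoN _ tphi) mulNmx mul1mx.
have dW : discriminant W != 0 by rewrite map_discriminant fmorph_eq0 ec_smooth.
exists H, J; split.
- by exists phi.
- have [Q|Q|Q] := automorphism_order n2 n3 dW An eA; [apply: Or31 | apply: Or32 | apply: Or33];
    apply: (phi_GL_inj tphi) => v.
  + by rewrite -powJ Q oppJ.
  + by rewrite -powJ3 Q GLval1 mul1mx.
  by rewrite -powJ3 Q oppJ.
- move=> g /H'E[sigma gs ag].
  have [h hP] := acts_as_exists tphi gs.
  have [g' ag' tw] := cases _ _ gs hP.
  exists h; first by apply/HE; exists sigma.
  by rewrite (phi_GL_inj (g := g) (h := g') tphi' _) // => v; rewrite -ag -ag'.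
move=> h /HE[sigma gs ah].
have [g ag tw] := cases _ _ gs ah.
by exists g => //; apply/H'E; exists sigma.
Qed.

End GaloisAction.

(** * Two-by-two matrices *)
Lemma lincomb3_eq0 (R : pzRingType) (a b c k1 k2 k3 d : R) :
  a = 0 -> b = 0 -> c = 0 -> d = k1 * a + k2 * b + k3 * c -> d = 0.
Proof. by move=> -> -> -> ->; rewrite !mulr0 !addr0. Qed.

Lemma conj_comm (R : unitRingType) (u a b : R) : u \is a GRing.unit ->
  (u * (a * u^-1) * b == b * (u * (a * u^-1)))
  = (a * (u^-1 * b * u) == u^-1 * b * u * a).
Proof.
move=> uu; have uV : u^-1 \is a GRing.unit by rewrite unitrV.
rewrite -(inj_eq (mulrI uV)) -(inj_eq (mulIr uu)).
by rewrite -!mulrA mulKr // mulrA mulVr // mulr1.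
Qed.

Section Mat2.
Variable F : fieldType.
Implicit Types (A B X Y N : 'M[F]_2) (v : 'cV[F]_2) (a b c d : F).

Definition mx2 a b c d : 'M[F]_2 :=
  \matrix_(i, j) (if i == 0 then if j == 0 then a else b else if j == 0 then c else d).
Definition cv2 a b : 'cV[F]_2 := \col_i (if i == 0 then a else b).

Lemma I2_ind (P : 'I_2 -> Prop) : P 0 -> P 1 -> forall i, P i.
Proof.
by move=> P0 P1 [[|[|i]] li] //; [move: P0 | move: P1]; congr P; apply: val_inj.
Qed.

Lemma sum2 (V : nmodType) (G : 'I_2 -> V) : \sum_(i < 2) G i = G 0 + G 1.
Proof. by rewrite big_ord_recl big_ord1; congr (_ + G _); apply: val_inj. Qed.

Lemma mx2P A : exists a b c d, A = mx2 a b c d.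
Proof.
exists (A 0 0), (A 0 1), (A 1 0), (A 1 1).
by apply/matrixP; apply: I2_ind; apply: I2_ind; rewrite mxE.
Qed.

Lemma cv2P v : exists a b, v = cv2 a b.
Proof.
exists (v 0 0), (v 1 0).
by apply/matrixP; apply: I2_ind => j; rewrite ord1 mxE.
Qed.

Lemma mx2_inj a b c d a' b' c' d' :
  mx2 a b c d = mx2 a' b' c' d' -> [/\ a = a', b = b', c = c' & d = d'].
Proof.
move/matrixP => e; move: (e 0 0) (e 0 1) (e 1 0) (e 1 1).
by rewrite !mxE.
Qed.

Lemma cv2_inj a b a' b' : cv2 a b = cv2 a' b' -> a = a' /\ b = b'.
Proof. by move/matrixP => e; move: (e 0 0) (e 1 0); rewrite !mxE. Qed.

Lemma mx2M a b c d a' b' c' d' : mx2 a b c d * mx2 a' b' c' d' =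
  mx2 (a * a' + b * c') (a * b' + b * d') (c * a' + d * c') (c * b' + d * d').
Proof.
by apply/matrixP; apply: I2_ind; apply: I2_ind; rewrite !mxE sum2 !mxE.
Qed.

Lemma mx2V a b c d x y : mx2 a b c d *m cv2 x y = cv2 (a * x + b * y) (c * x + d * y).
Proof. by apply/matrixP; apply: I2_ind => j; rewrite !mxE sum2 !mxE. Qed.

Lemma mx2D a b c d a' b' c' d' : mx2 a b c d + mx2 a' b' c' d' =
  mx2 (a + a') (b + b') (c + c') (d + d').
Proof. by apply/matrixP; apply: I2_ind; apply: I2_ind; rewrite !mxE. Qed.

Lemma mx2N a b c d : - mx2 a b c d = mx2 (- a) (- b) (- c) (- d).
Proof. by apply/matrixP; apply: I2_ind; apply: I2_ind; rewrite !mxE. Qed.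

Lemma mx2Z k a b c d : k *: mx2 a b c d = mx2 (k * a) (k * b) (k * c) (k * d).
Proof. by apply/matrixP; apply: I2_ind; apply: I2_ind; rewrite !mxE. Qed.

Lemma mx2_scalar a : a%:M = mx2 a 0 0 a.
Proof. by apply/matrixP; apply: I2_ind; apply: I2_ind; rewrite !mxE. Qed.

Lemma mx2_1 : 1 = mx2 1 0 0 1. Proof. exact: mx2_scalar. Qed.
Lemma mx2_0 : 0 = mx2 0 0 0 0.
Proof. by apply/matrixP; apply: I2_ind; apply: I2_ind; rewrite !mxE. Qed.

Lemma mx2_tr a b c d : \tr (mx2 a b c d) = a + d.
Proof. by rewrite /mxtrace sum2 !mxE. Qed.

Lemma mx2_det a b c d : \det (mx2 a b c d) = a * d - b * c.
Proof.
rewrite (expand_det_row _ 0) sum2 /cofactor !det_mx11 !mxE /=.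
ring.
Qed.

Lemma cv2Z k a b : k *: cv2 a b = cv2 (k * a) (k * b).
Proof. by apply/matrixP; apply: I2_ind => j; rewrite !mxE. Qed.
Lemma cv2D a b a' b' : cv2 a b + cv2 a' b' = cv2 (a + a') (b + b').
Proof. by apply/matrixP; apply: I2_ind => j; rewrite !mxE. Qed.
Lemma cv2_0 : 0 = cv2 0 0.
Proof. by apply/matrixP; apply: I2_ind => j; rewrite !mxE. Qed.

Definition mx2E := (mx2M, mx2V, mx2D, mx2N, mx2Z, mx2_scalar, mx2_1, mx2_0,
  mx2_tr, mx2_det, cv2Z, cv2D, cv2_0).

Lemma det_exp A n : \det (A ^+ n) = \det A ^+ n.
Proof. by elim: n => [|n IH]; rewrite ?expr0 ?det1 // !exprS detM IH. Qed.

Lemma CayleyHamilton2 A : A * A = \tr A *: A - (\det A)%:M.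
Proof.
by have [a [b [c [d ->]]]] := mx2P A; rewrite !mx2E; congr mx2; ring.
Qed.

Lemma det_sub_scalar A c : \det (A - c%:M) = c ^+ 2 - c * \tr A + \det A.
Proof. by have [a [b [c' [d ->]]]] := mx2P A; rewrite !mx2E; ring. Qed.

Lemma tr_square A : \tr (A * A) = \tr A ^+ 2 - 2%:R * \det A.
Proof. by have [a [b [c [d ->]]]] := mx2P A; rewrite !mx2E; ring. Qed.

Lemma kernel_line N v (x : 'cV[F]_2) : N != 0 -> v != 0 -> N *m v = 0 -> N *m x = 0 ->
  exists k, x = k *: v.
Proof.
have [a [b [c [d ->]]]] := mx2P N; have [v0 [v1 ->]] := cv2P v.
have [x0 [x1 ->]] := cv2P x; rewrite !mx2E => Nn vn /cv2_inj[e1 e2] /cv2_inj[e3 e4].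
have w0 : v0 * x1 - v1 * x0 = 0.
  apply: contraNeq Nn => wn.
  suff /andP[/andP[/eqP-> /eqP->] /andP[/eqP-> /eqP->]] :
    ((a == 0) && (b == 0)) && ((c == 0) && (d == 0)) by [].
  have z y : y * (v0 * x1 - v1 * x0) = 0 -> y == 0.
    by move/eqP; rewrite mulf_eq0 (negPf wn) orbF.
  rewrite !z //.
  - by apply: (lincomb2_eq0 (k1 := v0) (k2 := - x0) e4 e2); ring.
  - by apply: (lincomb2_eq0 (k1 := x1) (k2 := - v1) e2 e4); ring.
  - by apply: (lincomb2_eq0 (k1 := v0) (k2 := - x0) e3 e1); ring.
  by apply: (lincomb2_eq0 (k1 := x1) (k2 := - v1) e1 e3); ring.
have [v00|v0n] := eqVneq v0 0.
  have v1n : v1 != 0 by apply: contraNneq vn => v10; rewrite v00 v10.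
  exists (x1 / v1); rewrite cv2Z; congr cv2; last by field.
  rewrite v00 mulr0; apply: (mulfI v1n); rewrite mulr0.
  by move: w0; rewrite v00 mul0r sub0r => /eqP; rewrite oppr_eq0 => /eqP.
exists (x0 / v0); rewrite cv2Z; congr cv2; first by field.
by apply: (mulfI v0n); rewrite (subr0_eq w0); field.
Qed.

(** Nonzero nilpotent matrices have rank 1, and tr (N N') = 0 says that they have
    the same kernel. In coordinates, each entry of N N' has a square in the ideal
    generated by det N, det N' and tr (N N'). *)
Lemma nilpotents_tr0 N N' : \tr N = 0 -> \det N = 0 -> \tr N' = 0 -> \det N' = 0 ->
  \tr (N * N') = 0 -> N * N' = 0.
Proof.
have [a [b [c [d ->]]]] := mx2P N; have [a' [b' [c' [d' ->]]]] := mx2P N'.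
rewrite !mx2E => /eqP; rewrite addr_eq0 => /eqP -> e1 /eqP; rewrite addr_eq0 => /eqP -> e2 e3.
have sq0 (y : F) : y ^+ 2 = 0 -> y = 0 by move/eqP; rewrite expf_eq0 => /eqP.
congr mx2; apply: sq0.
- by apply: (lincomb3_eq0 (k1 := b' * c') (k2 := - d ^+ 2) (k3 := b * c') e1 e2 e3); ring.
- by apply: (lincomb3_eq0 (k1 := - b' ^+ 2) (k2 := - b ^+ 2) (k3 := - b * b') e1 e2 e3); ring.
- by apply: (lincomb3_eq0 (k1 := - c' ^+ 2) (k2 := - c ^+ 2) (k3 := - c * c') e1 e2 e3); ring.
by apply: (lincomb3_eq0 (k1 := b' * c') (k2 := - d ^+ 2) (k3 := c * b') e1 e2 e3); ring.
Qed.

Lemma det_eigenvector A k : \det (A - k%:M) = 0 -> exists2 v : 'cV[F]_2, v != 0 & A *m v = k *: v.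
Proof.
move=> dA; have /det0P[u un uA] : \det (A - k%:M)^T == 0 by rewrite det_tr dA.
exists u^T; first by apply: contraNneq un => e; rewrite -(trmxK u) e trmx0.
apply/eqP; rewrite -subr_eq0 -mul_scalar_mx -mulmxBl.
by apply/eqP; apply: trmx_inj; rewrite trmx_mul trmxK uA trmx0.
Qed.

Lemma centralizer_span X A : ~~ is_scalar_mx X -> A * X = X * A ->
  exists a b, A = a%:M + b *: X.
Proof.
have [a [b [c [d ->]]]] := mx2P X; have [a' [b' [c' [d' ->]]]] := mx2P A.
rewrite !mx2E => Xn /mx2_inj[e1 e2 e3 _].
have {}e1 : b' * c = c' * b by apply: (addrI (a' * a)); rewrite e1; ring.
have {}e2 : d' * b = a' * b + b' * d - a * b' by rewrite e2; ring.
have {}e3 : d' * c = c * a' + d * c' - c' * a by rewrite -e3; ring.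
have [b0|bn] := eqVneq b 0; last first.
  exists (a' - b' / b * a), (b' / b); rewrite !mx2E.
  have /(mulIf bn) dE : d' * b = (a' - b' / b * a + b' / b * d) * b by rewrite e2; field.
  have /(mulIf bn) cE : c' * b = (b' / b * c) * b by rewrite -e1; field.
  by congr mx2; rewrite ?dE ?cE; field.
have [c0|cn] := eqVneq c 0; last first.
  exists (a' - c' / c * a), (c' / c); rewrite !mx2E.
  have /(mulIf cn) dE : d' * c = (a' - c' / c * a + c' / c * d) * c by rewrite e3; field.
  have /(mulIf cn) bE : b' * c = (c' / c * b) * c by rewrite e1; field.
  by congr mx2; rewrite ?dE ?bE; field.
have adn : a - d != 0.
  rewrite subr_eq0; apply: contraNneq Xn => ->; rewrite b0 c0 -mx2_scalar.
  exact: scalar_mx_is_scalar.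
exists (a' - (a' - d') / (a - d) * a), ((a' - d') / (a - d)); rewrite !mx2E b0 c0.
have b'0 : b' = 0.
  apply: (mulIf adn); rewrite mul0r.
  by transitivity (d' * b - a' * b - (b' * d - a * b')); [rewrite b0 | rewrite e2]; ring.
have c'0 : c' = 0.
  apply: (mulIf adn); rewrite mul0r.
  by transitivity (d' * c - c * a' - (d * c' - c' * a)); [rewrite c0 | rewrite e3]; ring.
by congr mx2; rewrite ?b'0 ?c'0; field.
Qed.

Lemma centralizer_comm X A B : ~~ is_scalar_mx X -> A * X = X * A -> B * X = X * B ->
  A * B = B * A.
Proof.
move=> Xn /(centralizer_span Xn)[a [b ->]] /(centralizer_span Xn)[a' [b' ->]].
by have [x [y [z [t ->]]]] := mx2P X; rewrite !mx2E; congr mx2; ring.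
Qed.

(** A vector v that is not an eigenvector is cyclic, and v, X v are the columns
    of P. One of e1, e2, e1 + e2 will do. *)
Lemma companion_similar X : \tr X = 0 -> ~~ is_scalar_mx X ->
  exists2 P, P \in unitmx & X * P = P * mx2 0 (- \det X) 1 0.
Proof.
have [a [b [c [d ->]]]] := mx2P X; rewrite !mx2E => /eqP.
rewrite addrC addr_eq0 => /eqP -> Xn.
have [c0|cn] := eqVneq c 0; last first.
  exists (mx2 1 a 0 c); first by rewrite unitmxE mx2_det unitfE mul1r mulr0 subr0.
  by rewrite !mx2E; congr mx2; ring.
have [b0|bn] := eqVneq b 0; last first.
  exists (mx2 0 b 1 (- a)); first by rewrite unitmxE mx2_det unitfE mul0r mulr1 sub0r oppr_eq0.
  by rewrite !mx2E; congr mx2; ring: c0.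
have an : a - (- a) != 0.
  rewrite subr_eq0; apply: contraNneq Xn => an; rewrite -an b0 c0 -mx2_scalar.
  exact: scalar_mx_is_scalar.
exists (mx2 1 a 1 (- a)); first by rewrite unitmxE mx2_det unitfE -oppr_eq0 opprB !mul1r mulr1.
by rewrite !mx2E b0 c0; congr mx2; ring.
Qed.

End Mat2.

(** * Signs, stable lines and Borel groups *)
Section Minus1.
Variable p : nat.
Implicit Types (g h x : GL2 p) (H G : {group GL2 p}) (A B : {set GL2 p}).
Local Notation z := (minus1 p).

Lemma minus1_mul g : GLval (z * g)%g = - GLval g.
Proof. by rewrite GLvalM mulN1r. Qed.

Lemma minus1K : (z * z = 1)%g.
Proof. by apply: val_inj; rewrite /= mulrNN mulr1. Qed.

Lemma minus1C g : (g * z = z * g)%g.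
Proof. by apply: val_inj; rewrite /= mulrN1 mulN1r. Qed.

Lemma minus1J g : (z ^ g = z)%g.
Proof. by apply/conjg_fixP/commgP; rewrite /commute minus1C. Qed.

Lemma minus1_mulK g : (z * (z * g) = g)%g.
Proof. by rewrite mulgA minus1K mul1g. Qed.

(** For a group A this is the group generated by A and -1; its description as
    a set is all that is needed. *)
Definition pm (A : {set GL2 p}) := [set g | (g \in A) || ((z * g)%g \in A)].

Lemma pmJ A x : pm (A :^ x)%g = (pm A :^ x)%g.
Proof.
apply/setP => g; rewrite !(inE, mem_conjg) conjMg; congr (_ || (_ * _ \in A)%g).
by rewrite minus1J.
Qed.

Lemma sub_pm A : A \subset pm A.
Proof. by apply/subsetP => g gA; rewrite inE gA. Qed.

Lemma mem_pmN A g : ((z * g)%g \in pm A) = (g \in pm A).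
Proof. by rewrite !inE minus1_mulK orbC. Qed.

Lemma pm_id H : z \in H -> pm H = H.
Proof. by move=> zH; apply/setP => g; rewrite inE groupMl // orbb. Qed.

Definition SL2 := [set g : GL2 p | \det (GLval g) == 1].

Lemma SL2_group : group_set SL2.
Proof.
apply/group_setP; split=> [|g h]; rewrite !inE ?det1 // => /eqP g1 /eqP h1.
by rewrite GLvalM detM g1 h1 mulr1.
Qed.
Canonical SL2_is_group := Group SL2_group.

Definition stable_line (A : {set GL2 p}) (v : 'cV['F_p]_2) :=
  v != 0 /\ forall g, g \in A -> exists k, GLval g *m v = k *: v.

Lemma stable_line_pm A v : stable_line A v -> stable_line (pm A) v.
Proof.
case=> vn sv; split=> // g; rewrite inE => /orP[/sv//|/sv[k]].
by rewrite minus1_mul mulNmx => /eqP; rewrite eqr_oppLR => /eqP->; exists (- k); rewrite scaleNr.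
Qed.

Lemma stable_line_borel A v : stable_line A v -> in_borel A.
Proof.
have [v0 [v1 ->]] := cv2P v; case=> vn sv.
have [P Pu Pv] : exists2 P : 'M['F_p]_2, P \in unitmx & P *m cv2 1 0 = cv2 v0 v1.
  have [v00|v0n] := eqVneq v0 0.
    have v1n : v1 != 0 by apply: contraNneq vn => v10; rewrite v00 v10 cv2_0.
    exists (mx2 0 1 v1 0); last by rewrite mx2V v00; congr cv2; ring.
    by rewrite unitmxE mx2_det unitfE mul0r sub0r oppr_eq0 mul1r.
  exists (mx2 v0 0 v1 1); last by rewrite mx2V; congr cv2; ring.
  by rewrite unitmxE mx2_det unitfE mul0r subr0 mulr1.
pose x := GL2_of Pu.
exists (upper_triangular p :^ x^-1)%g; first by exists x^-1%g.
apply/subsetP => g /sv[k gv]; rewrite mem_conjgV inE conjgE.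
have : GLval (x^-1 * (g * x))%g *m cv2 1 0 = k *: cv2 1 0.
  rewrite !GLvalMx -!mulmxA Pv gv -Pv -scalemxAr; congr (_ *: _).
  by rewrite -[P]/(GLval x) mulmxA -GLvalMx mulVg mul1mx.
have [a [b [c [d E]]]] := mx2P (GLval (x^-1 * (g * x))%g).
rewrite E mx2V cv2Z => /cv2_inj[_ e]; apply/eqP.
have -> : ord_max = 1 :> 'I_2 by apply: val_inj.
by move: e; rewrite mxE /= !mulr0 mulr1 addr0.
Qed.

Lemma in_borelJ A x : in_borel A -> in_borel (A :^ x)%g.
Proof.
case=> B [y ->] sAB; exists (upper_triangular p :^ (y * x))%g; first by exists (y * x)%g.
by rewrite conjsgM conjSg.
Qed.

Lemma cartanJ (C : {set GL2 p}) x : cartan C -> cartan (C :^ x)%g.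
Proof.
rewrite /cartan /split_cartan /nonsplit_cartan.
case: eqP => [_ [->|[gC cC]]|_ [[y ->]|[e [y [en ->]]]]].
- by left; rewrite conjs1g.
- by right; split; [exact: (groupP (Group gC :^ x)) | rewrite cardJg].
- by left; exists (y * x)%g; rewrite conjsgM.
by right; exists e, (y * x)%g; rewrite conjsgM.
Qed.

Lemma in_normalizer_of_cartanJ A x :
  in_normalizer_of_cartan A -> in_normalizer_of_cartan (A :^ x)%g.
Proof.
case=> C cC nAC; exists (C :^ x)%g; first exact: cartanJ.
by rewrite normJ conjSg.
Qed.

Lemma in_borelS A B : A \subset B -> in_borel B -> in_borel A.
Proof. by move=> sAB [C bC sBC]; exists C => //; apply: subset_trans sBC. Qed.

Lemma in_normalizer_of_cartanS A B :
  A \subset B -> in_normalizer_of_cartan B -> in_normalizer_of_cartan A.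
Proof. by move=> sAB [C bC sBC]; exists C => //; apply: subset_trans sBC. Qed.

End Minus1.

(** By Cayley-Hamilton tr A *: A = 2, so A is scalar. *)
Lemma involution_SL2 (F : fieldType) (A : 'M[F]_2) : 2%:R != 0 :> F ->
  A * A = 1 -> \det A = 1 -> A = 1 \/ A = -1.
Proof.
move=> n2 AA dA.
have e : \tr A *: A = (2%:R)%:M.
  have := CayleyHamilton2 A; rewrite AA dA => /eqP; rewrite eq_sym subr_eq => /eqP->.
  by rewrite rmorph_nat mulr2n.
have tn : \tr A != 0.
  apply: contraNneq n2 => t0; move/matrixP/(_ 0 0): e; rewrite t0 scale0r !mxE /=.
  by rewrite mulr1n => /eqP; rewrite eq_sym.
have AE : A = (2%:R / \tr A)%:M.
  apply: (scalerI tn); rewrite e scale_scalar_mx; congr _%:M; by field.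
move: dA; rewrite AE det_scalar => /eqP; rewrite sqrf_eq1 => /orP[] /eqP ->; [left | right] => //.
by rewrite rmorphN.
Qed.

(** * Groups without -1 *)
Section Structure.
Variable p : nat.
Hypotheses (p_pr : prime p) (p_odd : p != 2%N).
Implicit Types (g h x : GL2 p) (H G : {group GL2 p}) (A B : {set GL2 p}).
Local Notation z := (minus1 p).

Lemma two_neq0 : 2%:R != 0 :> 'F_p.
Proof.
rewrite -(dvdn_pcharf (pchar_Fp p_pr)); apply: contra p_odd => /dvdn_leq.
by rewrite eqn_leq prime_gt1 // => ->.
Qed.

Lemma SL2_odd_order H g : z \notin H -> g \in H -> \det (GLval g) = 1 -> odd #[g]%g.
Proof.
have dX n : \det (GLval (g ^+ n)%g) = \det (GLval g) ^+ n by rewrite GLvalX det_exp.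
move=> zH gH dg; apply: contraR zH => ev.
have [w [/cycleP[n ->]]] := even_order_involution (cycle_id g) ev.
move=> /(congr1 (@GLval _ _)) w2 wn1.
have dw : \det (GLval (g ^+ n)%g) = 1 by rewrite dX dg expr1n.
have [w1|w1] := involution_SL2 two_neq0 w2 dw.
  by case/eqP: wn1; apply: GLval_inj.
have -> : z = (g ^+ n)%g by apply: GLval_inj.
exact: groupX.
Qed.

Lemma tr0_SL2_minus1 g : \det (GLval g) = 1 -> \tr (GLval g) = 0 -> (g ^+ 2 = z)%g.
Proof.
move=> dg tg; apply: val_inj; rewrite /= -[LHS]/(GLval g * GLval g).
by rewrite CayleyHamilton2 dg tg scale0r sub0r.
Qed.

Lemma trC (R : comPzRingType) n (M N : 'M[R]_n.+1) : \tr (M * N) = \tr (N * M).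
Proof. exact: mxtrace_mulC. Qed.

(** Let g = 1 + N. If a conjugate 1 + N' of g fixed another line then
    t = tr (N N') would be nonzero, and g^m (1 + N') would have trace
    2 + m t, which vanishes for a suitable m: its square would be -1. *)
Lemma unipotent_line H g : z \notin H -> g \in H ->
    \det (GLval g) = 1 -> \tr (GLval g) = 2%:R -> g != 1%g ->
  exists v, stable_line H v.
Proof.
move=> zH gH dg tg gn1.
pose N := GLval g - 1.
have gE : GLval g = 1 + N by rewrite /N addrC subrK.
have Nn : N != 0.
  by rewrite subr_eq0; apply: contraNneq gn1 => e; apply/eqP/val_inj.
have tN : \tr N = 0 by rewrite raddfB /= tg mxtrace1 subrr.
have dN : \det N = 0.
  by rewrite /N det_sub_scalar tg dg expr1n mul1r addrAC -mulr2n subrr.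
have NN : N * N = 0 by rewrite CayleyHamilton2 tN dN scale0r raddf0 subr0.
have gX k : GLval (g ^+ k)%g = 1 + N *+ k.
  rewrite GLvalX gE; elim: k => [|k IH]; first by rewrite mulr0n addr0.
  by rewrite exprS IH mulrDl mul1r mulrDr mulr1 mulrnAr NN mul0rn addr0 -addrA -mulrSr.
have NhN h : h \in H -> N * GLval h * N = 0.
  move=> hH; pose g' := (g ^ h^-1)%g.
  have hu := GLval_unit h.
  have g'H : g' \in H by apply: mem_conjV.
  pose N' := GLval h * N * (GLval h)^-1.
  have g'E : GLval g' = 1 + N'.
    by rewrite /g' GLvalJV gE mulrDl mulrDr mul1r mulrV // mulrA.
  have tN' : \tr N' = 0 by rewrite /N' trC mulrA mulVr // mul1r.
  have dN' : \det N' = 0 by rewrite /N' !detM dN mulr0 mul0r.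
  have t0 : \tr (N * N') = 0.
    apply: contraNeq zH => tn.
    (* the representative of -2 / t in {0, ..., p - 1} *)
    pose m : nat := (- 2%:R / \tr (N * N') : 'F_p).
    have mE : m%:R = - 2%:R / \tr (N * N') :> 'F_p by apply: natr_Zp.
    suff <- : ((g ^+ m * g') ^+ 2 = z)%g by apply: groupX; apply: groupM => //; apply: groupX.
    apply: tr0_SL2_minus1.
      rewrite GLvalM detM GLvalX.
      by rewrite /g' det_GLvalJ dg mulr1 det_exp dg expr1n.
    rewrite GLvalM gX g'E mulrDl mul1r mulrDr mulr1 !mxtraceD tN' mxtrace1.
    rewrite mulrnAl !raddfMn /= tN mul0rn add0r addr0 -[_ *+ m]mulr_natl mE.
    by rewrite divfK // subrr.
  have := nilpotents_tr0 tN dN tN' dN' t0; rewrite /N' => e.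
  apply: (@mulIr _ (GLval h)^-1); first by rewrite unitrV.
  by rewrite mul0r -e !mulrA.
have /matrix0Pn[i [j Nij]] := Nn.
exists (col j N); split; first by apply/matrix0Pn; exists i, 0; rewrite mxE.
have vn : col j N != 0 by apply/matrix0Pn; exists i, 0; rewrite mxE.
move=> h hH; apply: (kernel_line Nn vn); rewrite colE !mulmxA.
  by rewrite [N *m N]NN mul0mx.
by rewrite -[N *m _ *m N]/(N * GLval h * N) NhN // mul0mx.
Qed.

(** The eigenspace of X is a line because X is not scalar. *)
Lemma commuting_line (A : {set GL2 p}) (X : 'M['F_p]_2) k v : ~~ is_scalar_mx X ->
    v != 0 -> X *m v = k *: v -> (forall g, g \in A -> GLval g * X = X * GLval g) ->
  stable_line A v.
Proof.
move=> Xn vn Xv AX; split=> // g /AX gX.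
have XkE (w : 'cV_2) : (X - k%:M) *m w = X *m w - k *: w.
  by rewrite mulmxBl mul_scalar_mx.
apply: (kernel_line (N := X - k%:M)) => //.
- by rewrite subr_eq0; apply: contraNneq Xn => ->; apply: scalar_mx_is_scalar.
- by rewrite XkE Xv subrr.
rewrite XkE mulmxA -[X *m _]gX -[_ * X]/(_ *m X) -mulmxA Xv scalemxAr subrr //.
Qed.

(** A matrix killed by X^q - X, the product of all X - k, has an eigenvalue in
    the field. *)
Lemma card_power_eigenvector g : (g ^+ #|'F_p|)%g = g ->
  exists k, exists2 v : 'cV['F_p]_2, v != 0 & GLval g *m v = k *: v.
Proof.
move=> gq; set A := GLval g.
have /(congr1 (horner_mx A)) := finField_genPoly 'F_p.
rewrite rmorphB rmorphXn /= horner_mx_X /A -GLvalX gq subrr rmorph_prod => e.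
have : \prod_(x : 'F_p) \det (A - x%:M) = 0.
  rewrite -(big_morph (fun M : 'M['F_p]_2 => \det M) (@detM _ _) (det1 _ _)).
  under eq_bigr => x _ do rewrite -(horner_mx_X A) -(horner_mx_C A) -rmorphB.
  by rewrite -e det0.
move/eqP/prodf_eq0 => [k _ /eqP dk]; exists k; exact: det_eigenvector.
Qed.

(** The determinant embeds H into the multiplicative group of the field: H is
    abelian, and each of its elements is killed by X^q - X. *)
Lemma SL2_trivial_line H :
  (forall g, g \in H -> \det (GLval g) = 1 -> g = 1%g) -> exists v, stable_line H v.
Proof.
move=> H1.
have [[g gH gn]|sc] := pselect (exists2 g, g \in H & ~~ is_scalar_mx (GLval g)); last first.
  exists (delta_mx 0 0); split; first by apply/matrix0Pn; exists 0, 0; rewrite !mxE.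
  move=> g gH; have /is_scalar_mxP[k ->] : is_scalar_mx (GLval g).
    by apply/negPn/negP => gn; apply: sc; exists g.
  by exists k; rewrite mul_scalar_mx.
have gq : (g ^+ #|'F_p|)%g = g.
  apply/eqP; rewrite eq_mulgV1; apply/eqP/H1; first by rewrite groupM ?groupX ?groupV.
  rewrite GLvalM GLvalX detM GL_VxE det_inv.
  have dg : \det (GLval g) != 0 := det_GLval_neq0 g.
  by rewrite det_exp expf_card; exact: mulfV dg.
have [k [v vn gv]] := card_power_eigenvector gq.
exists v; apply: (commuting_line gn vn gv) => h hH.
suff hg : (h * g = g * h)%g by rewrite -!GLvalM hg.
apply/eqP; rewrite eq_mulgV1; apply/eqP/H1.
  by rewrite groupM ?groupV ?groupM.
have dC : \det (GLval (h * g)%g) = \det (GLval (g * h)%g) by rewrite !GLvalM !detM mulrC.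
by rewrite GLvalM detM dC -detM -GLvalM mulgV det1.
Qed.

Lemma tr_inv_SL2 g : \det (GLval g) = 1 -> \tr (GLval g^-1) = \tr (GLval g).
Proof.
move=> dg; have := CayleyHamilton2 (GLval g); rewrite dg => /(congr1 (fun M => (GLval g)^-1 * M)).
have gu := GLval_unit g.
rewrite mulKr // mulrBr mulr1 -scalerAr mulVr // GLvalV => /(congr1 mxtrace).
rewrite raddfB /= mxtraceZ mxtrace1 => /eqP; rewrite eq_sym subr_eq => /eqP e.
by apply: (addrI (\tr (GLval g))); rewrite -e mulr_natr mulr2n.
Qed.

(** The trace of X |-> M X N on the space of 2x2 matrices. *)
Lemma sum_delta_conj (R : fieldType) (M N : 'M[R]_2) :
  \sum_i \sum_j (M * delta_mx i j * N) i j = \tr M * \tr N.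
Proof.
have dE (i j : 'I_2) : delta_mx i j = mx2 ((i == 0) && (j == 0))%:R ((i == 0) && (j == 1))%:R
    ((i == 1) && (j == 0))%:R ((i == 1) && (j == 1))%:R :> 'M[R]_2.
  by apply/matrixP; apply: I2_ind; apply: I2_ind; rewrite !mxE ![_ == i]eq_sym ![_ == j]eq_sym.
have [a [b [c [d ->]]]] := mx2P M; have [a' [b' [c' [d' ->]]]] := mx2P N.
by rewrite !sum2 !dE !mx2M !mxE /= mx2_tr mx2_tr; ring.
Qed.

(** Let P X be the sum of all g X g^-1, so that P X centralizes G. As c - 1 is
    invertible and kills the sum of all g, that sum is 0; as squaring permutes G,
    this gives that tr(g)^2 sums to 2 #|G|, which is the trace of P. If all values
    of P were scalar, its trace would only be #|G|. *)
Lemma odd_SL2_centralizer G c : G \subset SL2 p -> odd #|G| -> ~~ (p %| #|G|)%N ->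
    c \in G -> \tr (GLval c) != 2%:R ->
  exists2 X : 'M['F_p]_2, ~~ is_scalar_mx X & forall g, g \in G -> GLval g * X = X * GLval g.
Proof.
move=> sGS oG pG cG tc.
have dG g : g \in G -> \det (GLval g) = 1 by move/(subsetP sGS); rewrite inE => /eqP.
have cardn : #|G|%:R != 0 :> 'F_p by rewrite -(dvdn_pcharf (pchar_Fp p_pr)).
have sum0 : \sum_(g in G) GLval g = 0.
  have cu : GLval c - 1 \in unitmx.
    rewrite unitmxE (det_sub_scalar _ 1) dG // expr1n mul1r addrAC -mulr2n unitfE.
    by rewrite subr_eq0 eq_sym.
  apply: (mulrI cu); rewrite mulr0 mulrBl mul1r mulr_sumr; apply/eqP.
  rewrite subr_eq0 [X in _ == X](reindex_inj (mulgI c)) /=; apply/eqP.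
  by apply: eq_big => g; rewrite ?groupMl.
have sumtr : \sum_(g in G) \tr (GLval g) = 0.
  by rewrite -(raddf_sum (@mxtrace _ 2)) sum0 raddf0.
have sumtr2 : \sum_(g in G) \tr (GLval g) ^+ 2 = (2 * #|G|)%:R.
  have co2 : coprime #|G| 2 by rewrite coprimen2.
  have inv2 g : g \in G -> ((g ^+ 2) ^+ expg_invn G 2 = g)%g by apply: (expgK co2).
  have : \sum_(g in G) \tr (GLval (g ^+ 2)%g) = 0.
    rewrite -[RHS]sumtr [RHS](reindex_onto (fun g => g ^+ 2)%g (fun g => g ^+ expg_invn G 2)%g) /=.
      apply: eq_bigl => g; apply/idP/andP => [gG | [g2G /eqP<-]].
        by split; [apply: groupX | rewrite inv2].
      exact: groupX.
    by move=> g gG; rewrite -expgM mulnC expgM inv2.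
  have -> : \sum_(g in G) \tr (GLval (g ^+ 2)%g)
      = \sum_(g in G) (\tr (GLval g) ^+ 2 - 2%:R).
    apply: eq_bigr => g gG.
    by rewrite GLvalX expr2 tr_square dG // mulr1.
  by rewrite sumrB sumr_const -mulrnA => /eqP; rewrite subr_eq0 => /eqP.
pose P (X : 'M['F_p]_2) := \sum_(g in G) GLval g * X * GLval g^-1.
have Pcomm X h : h \in G -> GLval h * P X = P X * GLval h.
  move=> hG; rewrite mulr_sumr mulr_suml [RHS](reindex_inj (mulgI h)).
  apply: eq_big => [g | g gG]; first by rewrite groupMl.
  rewrite invMg !GLvalM -!mulrA; congr (_ * (_ * (_ * _))).
  by rewrite !GLvalV mulVr ?GLval_unit // mulr1.
suff [X Xn] : exists X, ~~ is_scalar_mx (P X).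
  by exists (P X) => // g gG; apply: Pcomm.
apply: contrapT => /forallNP sc.
have {}sc X : exists k, P X = k%:M by apply/is_scalar_mxP/negPn/negP/sc.
case/eqP: cardn.
have trP : \sum_i \sum_j P (delta_mx i j) i j = (2 * #|G|)%:R.
  rewrite -sumtr2.
  under eq_bigr => i _ do under eq_bigr => j _ do rewrite summxE.
  under eq_bigr => i _ do rewrite exchange_big.
  rewrite exchange_big; apply: eq_bigr => g gG /=.
  by rewrite -[RHS]/(_ * _) -{2}(tr_inv_SL2 (dG g gG)) sum_delta_conj.
have P1 : P (delta_mx 0 0) + P (delta_mx 1 1) = (#|G|%:R)%:M.
  have -> : #|G|%:R%:M = P 1.
    rewrite /P (eq_bigr (fun=> 1)) ?sumr_const ?rmorph_nat // => g gG.
    by rewrite mulr1 -GLvalM mulgV.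
  rewrite /P -big_split /=; apply: eq_bigr => g _.
  rewrite -mulrDl -mulrDr; congr (_ * _ * _).
  by apply/matrixP; apply: I2_ind; apply: I2_ind; rewrite !mxE /= ?addr0 ?add0r.
move: trP; rewrite sum2 !sum2.
have [a Ea] := sc (delta_mx 0 0); have [b Eb] := sc (delta_mx 1 1).
have [c' Ec] := sc (delta_mx 0 1); have [d Ed] := sc (delta_mx 1 0).
rewrite Ea Eb in P1 *; rewrite Ec Ed; move/matrixP/(_ 0 0): P1; rewrite !mxE /= !mulr0n !mulr1n addr0 add0r.
by move=> ->; rewrite mul2n -addnn natrD -{1}[#|G|%:R]addr0 => /addrI.
Qed.

End Structure.

(** * The normalizer of a Cartan group *)
Section Axis.
Variable p : nat.
Hypotheses (p_pr : prime p) (p_odd : p != 2%N).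
Implicit Types (g h x : GL2 p) (H G : {group GL2 p}) (A B : {set GL2 p}).
Local Notation z := (minus1 p).
Let n2 := two_neq0 p_pr p_odd.

(** The centralizer of such a y is a Cartan group, with y spanning the elements of
    trace 0 in its algebra. Conjugation preserves this line up to sign: the first
    alternative is to lie in the Cartan group, the second is the other coset of
    its normalizer. *)
Definition cartan_axis A (y : 'M['F_p]_2) :=
  [/\ \tr y = 0, \det y != 0,
      forall h, h \in A -> GLval h * y = y * GLval h \/ GLval h * y = - (y * GLval h) &
      forall g, g \in A -> \det (GLval g) = 1 -> GLval g * y = y * GLval g].

Lemma nonscalar_tr0 (y : 'M['F_p]_2) : \tr y = 0 -> \det y != 0 -> ~~ is_scalar_mx y.
Proof.
move=> ty; apply: contra => /is_scalar_mxP[k yE]; move: ty.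
rewrite yE mxtrace_scalar det_scalar => /eqP.
by rewrite -mulr_natl mulf_eq0 (negPf n2) => /eqP->; rewrite expr0n.
Qed.

Lemma SL2_tr_neq H g : z \notin H -> (forall v, ~ stable_line H v) ->
  g \in H -> \det (GLval g) = 1 -> g != 1%g ->
  \tr (GLval g) != 2%:R /\ \tr (GLval g) != - 2%:R.
Proof.
move=> zH noline gH dg gn1.
have tr2 h : h \in H -> \det (GLval h) = 1 -> \tr (GLval h) = 2%:R -> h = 1%g.
  move=> hH dh th; apply/eqP/negPn/negP => hn1.
  by have [v /noline] := unipotent_line zH hH dh th hn1.
split; first by apply: contraNneq gn1 => /(tr2 _ gH dg)->.
apply/eqP => tg.
have g2 : (g ^+ 2 = 1)%g.
  apply: tr2; first by rewrite groupX.
    by rewrite GLvalX expr2 detM dg mulr1.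
  rewrite GLvalX expr2 tr_square tg dg; ring.
have [e|e] := involution_SL2 n2 (congr1 (@GLval _ _) g2 : GLval g * GLval g = 1) dg.
  by case/eqP: gn1; apply: val_inj.
by case/negP: zH; have -> : z = g by apply: val_inj.
Qed.

(** y is the trace-0 part of an element c != 1 of H1 = H n SL_2. It is not nilpotent
    because tr c is neither 2 nor -2. H1 is abelian, being in the centralizer of
    a nonscalar matrix; so for h in H the conjugate of y by h is again
    in the algebra of y, with the same trace and determinant: it is y or -y. *)
Lemma no_line_axis H : z \notin H -> (forall v, ~ stable_line H v) ->
  exists y, cartan_axis H y.
Proof.
move=> zH noline.
have trn g := SL2_tr_neq zH noline (g := g).
pose H1 := (H :&: SL2_is_group p)%G.
have mem1 g : (g \in H1) = (g \in H) && (\det (GLval g) == 1).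
  by rewrite /H1 /= !inE.
have [c cH1 cn1] : exists2 c, c \in H1 & c != 1%g.
  apply: contrapT => /forall2NP triv.
  have [g gH dg|v /noline//] := SL2_trivial_line (H := H).
  by apply/eqP/negPn/negP; case: (triv g) => //; rewrite mem1 gH dg eqxx.
have /andP[cH /eqP dc] : (c \in H) && (\det (GLval c) == 1) by rewrite -mem1.
have [tc2 tcN2] := trn _ cH dc cn1.
have oddH1 : odd #|H1|.
  apply: contraT; rewrite -dvdn2 => /(Cauchy (isT : prime 2))[w wH1 ow].
  move: wH1; rewrite mem1 => /andP[wH /eqP dw].
  by have := SL2_odd_order p_pr p_odd zH wH dw; rewrite ow.
have pH1 : ~~ (p %| #|H1|)%N.
  apply/negP => /(Cauchy p_pr)[w wH1 ow].
  move: wH1; rewrite mem1 => /andP[wH /eqP dw].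
  have wn1 : w != 1%g by rewrite -order_gt1 ow prime_gt1.
  have [tw _] := trn _ wH dw wn1.
  (* An element of order p would be unipotent: (w - 1)^p = w^p - 1. *)
  have pc : p \in [pchar 'M['F_p]_2].
    rewrite inE p_pr /=; apply/eqP.
    by rewrite -(rmorph_nat (@scalar_mx _ 2)) pchar_Fp_0 // raddf0.
  have wp : (GLval w - 1) ^+ p = 0.
    rewrite -(pFrobenius_autE pc) pFrobenius_autB_comm ?pFrobenius_autE; last exact: commr1.
    by have := expg_order w; rewrite ow -GLvalX expr1n => ->; rewrite subrr.
  have detp : \det (GLval w - 1) ^+ p = 0.
    by rewrite -det_exp wp det0.
  case/eqP: tw; move/eqP: detp; rewrite expf_eq0 (det_sub_scalar _ 1) dw => /andP[_].
  by rewrite expr1n mul1r addrAC -mulr2n subr_eq0 eq_sym => /eqP.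
have [X Xn XC] := odd_SL2_centralizer p_pr (subsetIr _ _ : H1 \subset SL2 p) oddH1 pH1 cH1 tc2.
pose t := \tr (GLval c) / 2%:R.
have [y yE] : exists y, y = GLval c - t%:M by exists (GLval c - t%:M).
have ty : \tr y = 0.
  by rewrite yE raddfB /= mxtrace_scalar -[t *+ 2]mulr_natr /t divfK // subrr.
have dy : \det y != 0.
  have tE : \tr (GLval c) = t * 2%:R by rewrite /t divfK.
  have -> : \det y = 1 - t ^+ 2 by rewrite yE det_sub_scalar dc tE; ring.
  rewrite subr_eq0 eq_sym sqrf_eq1 negb_or; apply/andP; split.
    by apply: contraNneq tc2 => t1; rewrite tE t1 mul1r.
  by apply: contraNneq tcN2 => t1; rewrite tE t1 mulN1r.
have yn := nonscalar_tr0 ty dy.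
have yC g : g \in H1 -> GLval g * y = y * GLval g.
  move=> gH1; rewrite yE mulrBr mulrBl; congr (_ - _); last exact: comm_mx_scalar.
  exact: centralizer_comm Xn (XC _ gH1) (XC _ cH1).
exists y; split=> // [h hH|g gH dg]; last by apply: yC; rewrite mem1 gH dg eqxx.
have hu := GLval_unit h.
pose y' := GLval h * y * (GLval h)^-1.
have y'E : y' = GLval (c ^ h^-1)%g - t%:M.
  rewrite /y' yE mulrBr mulrBl GLvalJV mulrA; congr (_ - _).
  by rewrite [GLval h * _]comm_mx_scalar mulrK.
have chH1 : (c ^ h^-1)%g \in H1.
  by rewrite mem1 det_GLvalJ dc eqxx andbT mem_conjV.
have [a [b ab]] : exists a b, y' = a%:M + b *: y.
  apply: centralizer_span yn _; have cy := yC _ chH1.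
  by rewrite y'E mulrBl mulrBr cy; congr (_ - _); apply: comm_scalar_mx.
have ty' : \tr y' = 0 by rewrite /y' trC mulrA mulVr // mul1r.
have dy' : \det y' = \det y.
  by rewrite /y' !detM mulrAC -detM mulrV // det1 mul1r.
have a0 : a = 0.
  move/eqP: ty'; rewrite ab raddfD /= mxtrace_scalar mxtraceZ ty mulr0 addr0.
  by rewrite -mulr_natl mulf_eq0 (negPf n2) => /eqP.
have b2 : b ^+ 2 = 1.
  by apply: (mulIf dy); rewrite mul1r -[RHS]dy' ab a0 raddf0 add0r detZ.
have hy : GLval h * y = b *: (y * GLval h).
  by rewrite -[LHS](mulrVK hu) -/y' ab a0 raddf0 add0r scalerAl.
by move/eqP: b2; rewrite sqrf_eq1 => /orP[] /eqP bE; [left | right];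
  rewrite hy bE ?scale1r ?scaleN1r.
Qed.

Definition centralizer2 (y : 'M['F_p]_2) : {set GL2 p} :=
  [set g : GL2 p | GLval g * y == y * GLval g].

Lemma centralizer2J (y : 'M['F_p]_2) h :
  (centralizer2 y :^ h)%g = centralizer2 ((GLval h)^-1 * y * GLval h).
Proof.
apply/setP => g; rewrite mem_conjg 2!in_set GLvalJV.
exact/conj_comm/GLval_unit.
Qed.

Lemma centralizer2N (y : 'M['F_p]_2) : centralizer2 (- y) = centralizer2 y.
Proof. by apply/setP => g; rewrite 2!in_set mulrN mulNr (inj_eq oppr_inj). Qed.

Lemma centralizer2_similar (y y' P : 'M['F_p]_2) : P \in unitmx -> y * P = P * y' ->
  exists x, centralizer2 y = (centralizer2 y' :^ x)%g.
Proof.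
move=> Pu yP; pose x := GL2_of Pu.
exists x^-1%g; rewrite centralizer2J GLvalV invrK; congr centralizer2.
by rewrite -[GLval x]/P -yP mulrK.
Qed.

Lemma centralizer2_companion d : centralizer2 (mx2 0 d 1 0) = nonsplit_form d.
Proof.
have o1 : ord_max = 1 :> 'I_2 by apply: val_inj.
apply/setP => g; rewrite !inE o1.
have [a [b [c [e ->]]]] := mx2P (GLval g); rewrite !mx2M !mxE /=.
apply/eqP/andP => [/mx2_inj[bE _ aE _] | [/eqP-> /eqP->]]; last by congr mx2; ring.
split; apply/eqP; first by move: aE; rewrite !mulr0 !mulr1 !mul0r !mul1r !add0r !addr0 => ->.
by move: bE; rewrite !mulr0 !mulr1 !mul0r !add0r.
Qed.

Lemma centralizer2_diag a : a != 0 -> centralizer2 (mx2 a 0 0 (- a)) = diagonal p.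
Proof.
move=> an; have o1 : ord_max = 1 :> 'I_2 by apply: val_inj.
apply/setP => g; rewrite !inE.
have [x [b [c [d E]]]] := mx2P (GLval g); rewrite E !mx2M.
have a2 : 2%:R * a != 0 by rewrite mulf_neq0.
apply/eqP/is_diag_mxP => [/mx2_inj[_ bE cE _] | dg].
  have b0 : b = 0.
    apply: (mulfI a2); rewrite mulr0.
    transitivity (a * b + 0 * d - (x * 0 + b * - a)); [ring | by rewrite bE subrr].
  have c0 : c = 0.
    apply: (mulfI a2); rewrite mulr0.
    transitivity (c * a + d * 0 - (0 * x + - a * c)); [ring | by rewrite cE subrr].
  by apply: I2_ind; apply: I2_ind => // _; rewrite mxE.
have b0 : b = 0 by have := dg 0 1 isT; rewrite mxE.
have c0 : c = 0 by have := dg 1 0 isT; rewrite mxE.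
by rewrite b0 c0; congr mx2; ring.
Qed.

(** Every y with trace 0 is similar to the companion matrix of X^2 + det y, whose
    centralizer is the non-split form. When - det y is a square a^2 this companion
    matrix is also similar to diag(a, -a). *)
Lemma centralizer2_cartan (y : 'M['F_p]_2) :
  \tr y = 0 -> \det y != 0 -> cartan (centralizer2 y).
Proof.
move=> ty dy; have yn := nonscalar_tr0 ty dy.
have [P Pu yP] := companion_similar ty yn.
rewrite /cartan /split_cartan /nonsplit_cartan (negPf p_odd).
have [[a aE]|nsq] := pselect (exists a, a ^+ 2 = - \det y); [left | right].
  have an : a != 0.
    by apply: contraNneq dy => a0; rewrite -oppr_eq0 -aE a0 expr0n.
  pose D := mx2 a 0 0 (- a).
  have tD : \tr D = 0 by rewrite mx2_tr subrr.
  have dD : - \det D = - \det y by rewrite mx2_det -aE; ring.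
  have Dn : ~~ is_scalar_mx D.
    by apply: nonscalar_tr0 => //; rewrite -oppr_eq0 dD oppr_eq0.
  have [Q Qu DQ] := companion_similar tD Dn; rewrite dD in DQ.
  have [x ->] : exists x, centralizer2 y = (centralizer2 D :^ x)%g.
    apply: (centralizer2_similar (P := P * Q^-1)); first by rewrite unitmx_mul Pu unitmx_inv.
    rewrite mulrA yP -!mulrA; congr (_ * _).
    by apply: (canRL (mulKr Qu)); rewrite !mulrA -DQ mulrK.
  by exists x; rewrite centralizer2_diag.
have [x ->] := centralizer2_similar Pu yP.
exists (- \det y), x; split; last by rewrite centralizer2_companion.
by move=> a; apply/eqP => aE; apply: nsq; exists a.
Qed.

Lemma axis_normalizer A y : cartan_axis A y -> in_normalizer_of_cartan (pm A).
Proof.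
case=> ty dy Ay _; exists (centralizer2 y); first exact: centralizer2_cartan.
have pmy h : h \in pm A -> GLval h * y = y * GLval h \/ GLval h * y = - (y * GLval h).
  rewrite inE => /orP[/Ay//|/Ay]; rewrite minus1_mul !mulNr mulrN.
  by case=> [/oppr_inj|/oppr_inj]; [left | right].
apply/subsetP => h /pmy hy; have hu := GLval_unit h.
have yh : y * GLval h = GLval h * y \/ y * GLval h = - (GLval h * y).
  by case: hy => ->; [left | right]; rewrite ?opprK.
rewrite inE centralizer2J -mulrA.
case: yh => ->; first by rewrite mulKr.
by rewrite mulrN mulKr // centralizer2N.
Qed.

End Axis.

(** * Groups with the same +-H *)
Section Count.
Variable p : nat.
Hypotheses (p_pr : prime p) (p_odd : p != 2%N).
Implicit Types (g h x : GL2 p) (H G L M : {group GL2 p}) (A B : {set GL2 p}).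
Local Notation z := (minus1 p).

Lemma odd_mem_pm H g : z \notin H -> odd #[g]%g -> g \in pm H -> g \in H.
Proof.
move=> zH og; rewrite inE => /orP[//|zgH]; case/negP: zH.
by apply: odd_order_mem (minus1K p) _ og zgH; apply/esym/minus1C.
Qed.

Lemma pm_sub_eq H L : z \notin L -> pm H = pm L -> H \subset L -> H = L.
Proof.
move=> zL pmHL sHL; apply/val_inj/eqP; rewrite /= eqEsubset sHL; apply/subsetP => g gL.
have : g \in pm H by rewrite pmHL (subsetP (sub_pm L)).
rewrite inE => /orP[//|/(subsetP sHL) zgL]; case/negP: zL.
by rewrite -(groupMr _ gL).
Qed.

(** The determinants of A are the powers of det h. *)
Definition det_generator (A : {set GL2 p}) h :=
  h \in A /\ forall g, g \in A -> exists k, \det (GLval g) = \det (GLval (h ^+ k)%g).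

Lemma det_generator_exists H : exists h, det_generator H h.
Proof.
have du g : \det (GLval g) \is a GRing.unit by rewrite unitfE; apply: det_GLval_neq0.
pose D g : {unit 'F_p} := FinRing.unit _ (du g).
have DM : {in H &, {morph D : x y / x * y}}%g.
  by move=> g h _ _; apply: val_inj; rewrite /= detM.
have /cyclicP[d dE] := field_unit_group_cyclic (Morphism DM @* H)%G.
have : d \in (Morphism DM @* H)%g by rewrite dE cycle_id.
case/morphimP => h _ hH dh; exists h; split=> // g gH.
have : D g \in (Morphism DM @* H)%g by apply: mem_morphim.
rewrite dE => /cycleP[k e]; exists k.
have /(congr1 val) := e; rewrite dh -[RHS]/(val (D h ^+ k)%g) => /= ->.
have -> : (D h ^+ k)%g = D (h ^+ k)%g.
  elim: k {e} => [|k IH]; first by rewrite !expg0; apply: val_inj; rewrite /= det1.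
  by rewrite expgS IH; apply: val_inj; rewrite expgS /= detM.
by [].
Qed.

(** Modulo a power of h, an element of H has determinant 1, hence odd order, and
    is then in L. *)
Lemma det_generator_eq H L h : z \notin H -> z \notin L -> pm H = pm L ->
  det_generator H h -> h \in L -> H = L.
Proof.
move=> zH zL pmHL [hH hgen] hL; apply: pm_sub_eq => //; apply/subsetP => g gH.
have [k gk] := hgen _ gH.
rewrite -[g](mulgKV (h ^+ k)%g) groupM ?groupX //.
have ghH : (g * (h ^+ k)^-1)%g \in H by rewrite groupM ?groupV ?groupX.
apply: odd_mem_pm => //; last by rewrite -pmHL (subsetP (sub_pm H)).
apply: (SL2_odd_order p_pr p_odd zH ghH).
by rewrite GLvalM detM gk -detM -GLvalM mulgV det1.
Qed.

Lemma det_minus1 g : \det (GLval (z * g)%g) = \det (GLval g).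
Proof. by rewrite minus1_mul -scaleN1r detZ sqrrN expr1n mul1r. Qed.

Lemma det_generatorN H L h : pm H = pm L -> det_generator H h -> (z * h)%g \in L ->
  det_generator L (z * h)%g.
Proof.
move=> pmHL [hH hgen] zhL; split=> // g gL.
have dX k : \det (GLval ((z * h) ^+ k)%g) = \det (GLval (h ^+ k)%g).
  by rewrite !GLvalX !det_exp det_minus1.
have : g \in pm H by rewrite pmHL (subsetP (sub_pm L)).
rewrite inE => /orP[] /hgen[k gk]; exists k; rewrite dX -gk //.
by rewrite det_minus1.
Qed.

(** For A = +-G these are the proper subgroups from which adding -1 recovers A. *)
Definition twins (A : {set GL2 p}) := [set L : {group GL2 p} | (z \notin L) && (pm L == A)].

Lemma twinsP A H L : H \in twins A -> L \in twins A -> pm H = pm L.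
Proof. by rewrite !inE => /andP[_ /eqP->] /andP[_ /eqP->]. Qed.

Lemma generator_or_opposite H L h : pm H = pm L -> det_generator H h ->
  h \in L \/ (z * h)%g \in L.
Proof.
move=> pmHL [hH _]; have : h \in pm L by rewrite -pmHL (subsetP (sub_pm H)).
by rewrite inE => /orP.
Qed.

(** If h is a determinant generator of one member, every member contains h or -h,
    and either choice determines it. *)
Lemma card_twins A : (#|twins A| <= 2)%N.
Proof.
have [-> | [H HA]] := set_0Vmem (twins A); first by rewrite cards0.
have zH : z \notin H by move: HA; rewrite inE => /andP[].
have [h hgen] := det_generator_exists H.
have [[M MA zhM]|noM] := pselect (exists2 M, M \in twins A & (z * h)%g \in M).
  suff /subset_leq_card : twins A \subset [set H; M] by move/leq_trans; apply; rewrite cards2; case: (_ == _).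
  apply/subsetP => L LA; rewrite !inE.
  have zL : z \notin L by move: LA; rewrite inE => /andP[].
  have zM : z \notin M by move: MA; rewrite inE => /andP[].
  have [hL|zhL] := generator_or_opposite (twinsP HA LA) hgen.
    by rewrite (det_generator_eq zH zL (twinsP HA LA) hgen hL) eqxx.
  have Mgen := det_generatorN (twinsP HA MA) hgen zhM.
  by rewrite (det_generator_eq zM zL (twinsP MA LA) Mgen zhL) eqxx orbT.
suff /subset_leq_card : twins A \subset [set H] by move/leq_trans; apply; rewrite cards1.
apply/subsetP => L LA; rewrite inE.
have zL : z \notin L by move: LA; rewrite inE => /andP[].
have [hL|zhL] := generator_or_opposite (twinsP HA LA) hgen.
  by rewrite (det_generator_eq zH zL (twinsP HA LA) hgen hL).
by case: noM; exists L.
Qed.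

(** For y as in cartan_axis and a determinant generator h of H, if L does not
    contain h then it contains -h. If h y = - y h, conjugation by y sends h to
    -h and preserves +-H. Otherwise H is in the torus of y, which is not split
    as there is no stable line; its only involution is -1, so H has odd order,
    and the elements of odd order of +-H all lie in L. *)
Lemma twins_conjugate A H L : (forall v, ~ stable_line A v) ->
  H \in twins A -> L \in twins A -> exists x, L :=: (H :^ x)%g.
Proof.
move=> noline HA LA; have pmHL := twinsP HA LA.
have /andP[zH /eqP pmH] : (z \notin H) && (pm H == A) by move: HA; rewrite inE.
have /andP[zL _] : (z \notin L) && (pm L == A) by move: LA; rewrite inE.
have nolineH v : ~ stable_line H v.
  by move/stable_line_pm; rewrite pmH; apply: noline.
have [y [ty dy Hy Hy1]] := no_line_axis p_pr p_odd zH nolineH.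
have yn := nonscalar_tr0 p_pr p_odd ty dy.
have [h hgen] := det_generator_exists H; case: (hgen) => hH gens.
have [hL|zhL] := generator_or_opposite pmHL hgen.
  by exists 1%g; rewrite conjsg1 (det_generator_eq zH zL pmHL hgen hL).
have [hy|hy] := Hy h hH; last first.
  have yu : y \in unitmx by rewrite unitmxE unitfE.
  pose x := GL2_of yu.
  have gxN g : GLval g * y = - (y * GLval g) -> (g ^ x^-1 = z * g)%g.
    move=> gy; have yg : y * GLval g = - (GLval g * y) by rewrite gy opprK.
    apply: GLval_inj; rewrite GLvalJV minus1_mul -[GLval x]/y mulrA yg mulNr.
    by rewrite mulrK.
  have gx g : g \in H -> (g ^ x^-1)%g \in pm H.
    move=> gH; case: (Hy g gH) => gy; last by rewrite gxN // mem_pmN (subsetP (sub_pm H)).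
    suff -> : (g ^ x^-1 = g)%g by rewrite (subsetP (sub_pm H)).
    by apply: GLval_inj; rewrite GLvalJV -[GLval x]/y mulrA -gy mulrK.
  have zHx : z \notin (H :^ x^-1)%G by rewrite /= mem_conjg minus1J.
  have pmx : pm (H :^ x^-1)%G = pm H.
    rewrite pmJ; apply/eqP; rewrite eqEcard cardJg leqnn andbT; apply/subsetP => g.
    rewrite mem_conjg invgK => gx'; rewrite -[g](conjgK x).
    move: gx'; rewrite inE => /orP[/gx//|/gx].
    by rewrite conjMg minus1J mem_pmN.
  exists x^-1%g; rewrite -[RHS]/(gval (H :^ x^-1)%G); congr gval.
  apply/esym; apply: (det_generator_eq (h := (z * h)%g)) => //.
  - by rewrite pmx.
  - apply: det_generatorN hgen _; first by rewrite pmx.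
    have <- : (h ^ x^-1 = z * h)%g by apply: gxN.
    by rewrite /= memJ_conjg.
have Hcomm g : g \in H -> GLval g * y = y * GLval g.
  move=> gH; have [k gk] := gens g gH.
  have hky : GLval (h ^+ k)%g * y = y * GLval (h ^+ k)%g.
    by rewrite GLvalX; apply: commr_sym; apply: commrX.
  pose s := (g * (h ^+ k)^-1)%g.
  have sy : GLval s * y = y * GLval s.
    apply: Hy1; first by rewrite groupM ?groupV ?groupX.
    by rewrite GLvalM detM gk -detM -GLvalM mulgV det1.
  have -> : GLval g = GLval s * GLval (h ^+ k)%g by rewrite -GLvalM mulgKV.
  by rewrite -mulrA hky mulrA sy -mulrA.
have nsq a : a ^+ 2 != - \det y.
  apply/eqP => aE.
  have [v vn yv] : exists2 v : 'cV['F_p]_2, v != 0 & y *m v = a *: v.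
    by apply: det_eigenvector; rewrite det_sub_scalar ty aE mulr0 subr0 addNr.
  exact: nolineH (commuting_line yn vn yv Hcomm).
have oH g : g \in H -> odd #[g]%g.
  move=> gH; apply: contraR zH => /(even_order_involution gH)[w [wH w2 wn1]].
  have ww : GLval w * GLval w = 1 by rewrite -GLvalM w2.
  have [a [b wE]] := centralizer_span yn (Hcomm w wH).
  (* The algebra of y is a field. *)
  have unit0 c : \det (c%:M + b *: y) = 0 -> c%:M + b *: y = 0.
    have -> : \det (c%:M + b *: y) = c ^+ 2 + b ^+ 2 * \det y.
      have := det_sub_scalar (b *: y) (- c).
      rewrite raddfN opprK addrC detZ mxtraceZ ty => ->; ring.
    have [-> | bn] := eqVneq b 0.
      by rewrite expr0n mul0r addr0 => /eqP; rewrite expf_eq0 => /eqP ->; rewrite scale0r raddf0 addr0.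
    move/eqP; rewrite addr_eq0 => /eqP cE; case/eqP: (nsq (c / b)).
    by rewrite expr_div_n cE mulrC mulrN mulKf ?expf_neq0.
  have w1E : GLval w - 1 = (a - 1)%:M + b *: y by rewrite wE raddfB /= addrAC.
  have w2E : GLval w + 1 = (a + 1)%:M + b *: y by rewrite wE raddfD /= addrAC.
  have : \det (GLval w - 1) * \det (GLval w + 1) = 0.
    have -> : \det (GLval w - 1) * \det (GLval w + 1) = \det ((GLval w - 1) * (GLval w + 1)).
      by rewrite detM.
    by rewrite mulrDr mulr1 mulrBl mul1r ww subrKA subrr det0.
  move/eqP; rewrite mulf_eq0 => /orP[] /eqP.
    rewrite w1E => /unit0; rewrite -w1E => /eqP; rewrite subr_eq0 => /eqP w1.
    by case/eqP: wn1; apply: GLval_inj.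
  rewrite w2E => /unit0; rewrite -w2E => /eqP; rewrite addr_eq0 => /eqP w1.
  by have -> : z = w by apply: GLval_inj.
exists 1%g; rewrite conjsg1; congr gval; apply/esym/pm_sub_eq => //.
apply/subsetP => g gH; apply: (odd_mem_pm zL (oH g gH)).
by rewrite -pmHL (subsetP (sub_pm H)).
Qed.

End Count.

(** * Comparing the images of two twists *)
Section TwistedGroups.
Variable p : nat.
Hypothesis p_pr : prime p.
Implicit Types (g h x J : GL2 p) (H G L : {group GL2 p}).
Local Notation z := (minus1 p).

Lemma pm_twisted H H' x :
    (forall g, g \in H' -> exists2 h, h \in H & g = (h ^ x)%g \/ g = (z * h ^ x)%g) ->
    (forall h, h \in H -> exists2 g, g \in H' & g = (h ^ x)%g \/ g = (z * h ^ x)%g) ->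
  pm H' = (pm H :^ x)%g.
Proof.
move=> HH' H'H.
have pmx h : h \in H -> (h ^ x)%g \in pm (H :^ x)%g.
  by move=> hH; apply: (subsetP (sub_pm _)); rewrite memJ_conjg.
have sub1 g : g \in H' -> g \in pm (H :^ x)%g.
  by move=> /HH'[h hH [->|->]]; rewrite ?mem_pmN pmx.
have sub2 h : h \in H -> (h ^ x)%g \in pm H'.
  move=> /H'H[g gH' [e|e]]; first by rewrite -e (subsetP (sub_pm _)).
  by rewrite -mem_pmN -e (subsetP (sub_pm _)).
rewrite -pmJ; apply/setP => g; apply/idP/idP.
  by rewrite {1}inE => /orP[/sub1//|/sub1]; rewrite mem_pmN.
rewrite {1}inE !mem_conjg => /orP[/sub2|/sub2]; first by rewrite conjgKV.
by rewrite conjgKV mem_pmN.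
Qed.

(** From J h J = h we get h^J = J^-1 h J = J^-2 h, which is J^-3 (J h). *)
Lemma twisted_order6 J h g : (J * (J * J) = 1 \/ J * (J * J) = z)%g -> twisted_by J h g ->
  (g = h ^ J \/ g = z * h ^ J)%g.
Proof.
move=> J3 [[-> hJ]|[-> JhJ]]; first by left; rewrite conjgE hJ mulKg.
have J2h : (J * (J * h ^ J) = h)%g by rewrite conjgE mulKVg mulgA.
have J3h : (J * h = J * (J * J) * h ^ J)%g by rewrite -{1}J2h !mulgA.
by rewrite J3h; case: J3 => ->; [left; rewrite mul1g | right].
Qed.

(** Conjugate by P = 1 + J, which divides 2: since J h J = h,
    (J h) P = J h + h = P h. *)
Lemma twisted_order4 J : p != 2%N -> (J * J = z)%g ->
  exists x, forall h g, twisted_by J h g -> (g = h ^ x)%g.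
Proof.
move=> p_odd J2; have J2' : GLval J * GLval J = -1 by rewrite -GLvalM J2.
have Pu : 1 + GLval J \in unitmx.
  have e : (1 + GLval J) * (1 - GLval J) = (2%:R)%:M.
    by rewrite mulrDl mul1r mulrBr mulr1 J2' opprK addrA subrK rmorph_nat -mulr2n.
  have : \det (1 + GLval J) * \det (1 - GLval J) = 2%:R ^+ 2.
    have <- : \det ((1 + GLval J) * (1 - GLval J)) = 2%:R ^+ 2 by rewrite e det_scalar.
    by rewrite detM.
  move=> d2; rewrite unitmxE unitfE; apply: contraNneq (two_neq0 p_pr p_odd) => d0.
  by move/eqP: d2; rewrite d0 mul0r eq_sym expf_eq0.
exists (GL2_of Pu)^-1%g => h g tw; apply: GLval_inj; rewrite GLvalJV GLval_of mulrA.
apply: (canRL (mulrK Pu)); rewrite mulrDr mulr1 mulrDl mul1r.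
case: tw => [[-> hJ] | [-> JhJ]]; first by rewrite -!GLvalM hJ.
by rewrite -!GLvalM JhJ addrC.
Qed.

Lemma pm_twist H H' J : p != 2%N ->
    [\/ (J * J = z)%g, (J * (J * J) = 1)%g | (J * (J * J) = z)%g] ->
    (forall g, g \in H' -> exists2 h, h \in H & twisted_by J h g) ->
    (forall h, h \in H -> exists2 g, g \in H' & twisted_by J h g) ->
  exists x, pm H' = (pm H :^ x)%g.
Proof.
move=> p_odd Jn HH' H'H.
suff [x xP] : exists x, forall h g, twisted_by J h g -> (g = h ^ x \/ g = z * h ^ x)%g.
  exists x; apply: pm_twisted => [g /HH'[h hH /xP e] | h /H'H[g gH /xP e]].
    by exists h.
  by exists g.
case: Jn => Jn; last 2 first.
- by exists J => h g; apply: twisted_order6; left.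
- by exists J => h g; apply: twisted_order6; right.
by have [x xP] := twisted_order4 p_odd Jn; exists x => h g /xP; left.
Qed.

End TwistedGroups.

(** * Counting conjugacy classes *)
Section Classes.
Variable p : nat.
Hypothesis p_pr : prime p.
Implicit Types (g h x : GL2 p) (H G L : {group GL2 p}) (A B : {set GL2 p}).
Local Notation z := (minus1 p).
Local Notation class A := (A :^: [set: GL2 p])%g.

Lemma classJ A x : class (A :^ x)%g = class A.
Proof. by rewrite conjugates_conj lcoset_id ?inE. Qed.

Lemma card_classes_odd (P : pred {group GL2 p}) H : p != 2%N ->
    (forall L, P L -> exists x, pm L = (pm H :^ x)%g) ->
  let n := #|[set class L | L : {group GL2 p} & P L]| in
  [/\ (n <= 3)%N,
      n = 3%N -> exists v, stable_line (pm H) v &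
      n = 2%N -> in_borel (pm H) \/ in_normalizer_of_cartan (pm H)].
Proof.
move=> p_odd PH; set X := [set _ | _ in _].
pose Y := [set class L | L : {group GL2 p} in twins (pm H)].
have sXY : X \subset class (pm H) |: Y.
  apply/subsetP => C /imsetP[L LX ->{C}].
  move: LX; rewrite inE => /PH[x pmL]; rewrite in_setU1.
  have [zL|zL] := boolP (z \in L).
    by rewrite -(pm_id zL) pmL classJ eqxx.
  apply/orP; right; apply/imsetP; exists (L :^ x^-1)%G; last by rewrite /= classJ.
  rewrite inE /= mem_conjgV minus1J zL pmJ pmL; apply/eqP.
  by rewrite -conjsgM mulgV conjsg1.
have cY : (#|Y| <= #|twins (pm H)|)%N by apply: leq_imset_card.
have cX : (#|X| <= 1 + #|Y|)%N.
  by apply: leq_trans (subset_leq_card sXY) _; rewrite cardsU1 leq_add2r leq_b1.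
split.
- apply: leq_trans cX _; rewrite add1n ltnS.
  exact: leq_trans cY (card_twins p_pr p_odd _).
- move=> n3; apply: contrapT => /forallNP noline.
  suff Y1 : (#|Y| <= 1)%N by move: cX; rewrite n3 add1n ltnS ltnNge Y1.
  apply/card_le1_eqP => _ _ /imsetP[L LH ->] /imsetP[M MH ->].
  have [x ->] := twins_conjugate p_pr p_odd noline LH MH.
  by rewrite classJ.
move=> n2; have [t0|[L LH]] := set_0Vmem (twins (pm H)).
  by move: cX; rewrite n2 add1n ltnS ltnNge (leq_trans cY) // t0 cards0.
have /andP[zL /eqP pmL] : (z \notin L) && (pm L == pm H) by move: LH; rewrite inE.
have [[v sv]|/forallNP noline] := pselect (exists v, stable_line L v).
  by left; rewrite -pmL; apply: stable_line_borel (stable_line_pm sv).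
right; rewrite -pmL; have [y] := no_line_axis p_pr p_odd zL noline.
exact: axis_normalizer.
Qed.

End Classes.

Section ClassesAt2.
Implicit Types (g h x : GL2 2) (H G L M : {group GL2 2}).
Local Notation class A := (A :^: [set: GL2 2])%g.

Lemma card_GL2_2 : #|[set: GL2 2]| = 6%N.
Proof. by rewrite (card_GL_2 'F_2) card_Fp. Qed.

(** Orders 1 and 6 are trivial, and groups of order 2 or 3 are Sylow groups. *)
Lemma class_card L M : #|L| = #|M| -> class L = class M.
Proof.
move=> cLM.
suff [x ->] : exists x, L :=: (M :^ x)%g by rewrite classJ.
have := cardSg (subsetT L); rewrite card_GL2_2 => dL.
have : #|L| \in divisors 6 by rewrite -dvdn_divisors.
have sylow q : prime q -> logn q 6 = 1%N -> #|L| = q -> exists x, L :=: (M :^ x)%g.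
  move=> q_pr q6 Lq.
  have syl (N : {group GL2 2}) : #|N| = q -> (q.-Sylow([set: GL2 2]) N)%g.
    by move=> Nq; rewrite pHallE subsetT /= card_GL2_2 p_part q6 Nq.
  have [x _ ->] := Sylow_trans (syl M (etrans (esym cLM) Lq)) (syl L Lq).
  by exists x.
rewrite !inE => /or4P[] /eqP Lc.
- exists 1%g; rewrite conjsg1 (card1_trivg Lc) (card1_trivg (etrans (esym cLM) Lc)) //.
- exact: sylow Lc.
- exact: sylow Lc.
have full (N : {group GL2 2}) : #|N| = 6%N -> N :=: setT.
  by move=> N6; apply/eqP; rewrite eqEcard subsetT card_GL2_2 N6.
by exists 1%g; rewrite conjsg1 (full L Lc) (full M) // -cLM.
Qed.

(** The orders divide 6, and among 1, 2, 3, 6 the divisibility by 3 leaves two. *)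
Lemma card_classes_2 (P : pred {group GL2 2}) (b : bool) :
    (forall L, P L -> (3 %| #|L|)%N = b) ->
  (#|[set class L | L : {group GL2 2} & P L]| <= 2)%N.
Proof.
move=> Pb; pose f n := if [pick L : {group GL2 2} | #|L| == n] is Some L then class L else set0.
have fE L : f #|L| = class L.
  by rewrite /f; case: pickP => [M /eqP|/(_ L)]; [apply: class_card | rewrite eqxx].
suff /subset_leq_card : [set class L | L : {group GL2 2} & P L]
    \subset [set f (if b then 3 else 1)%N; f (if b then 6 else 2)%N].
  by move/leq_trans; apply; rewrite cards2; case: (_ == _).
apply/subsetP => C /imsetP[L LX ->{C}]; move: LX; rewrite inE => /Pb L3.
have := cardSg (subsetT L); rewrite card_GL2_2 dvdn_divisors // -fE !inE.
by case: (b) L3 => L3 /or4P[] /eqP Lc; move: L3; rewrite Lc // eqxx ?orbT.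
Qed.

Lemma twisted_by_square (p : nat) (J h g : GL2 p) : twisted_by J h g -> (g * g = h * h)%g.
Proof.
by case=> [[-> _]|[-> JhJ]] //; rewrite mulgA JhJ.
Qed.

End ClassesAt2.

Section Main.
Variables (K : fieldType) (Kbar : closedFieldType) (iota : {rmorphism K -> Kbar}).
Variable E : elliptic_curve K.
Hypotheses (c2 : 2%:R != 0 :> Kbar) (c3 : 3%:R != 0 :> Kbar).

(** An element of order 3 is a fourth power, and twisting does not change
    squares. *)
Lemma dvd3_twist (H H' : {group GL2 2}) J :
    (forall g, g \in H' -> exists2 h, h \in H & twisted_by J h g) ->
    (forall h, h \in H -> exists2 g, g \in H' & twisted_by J h g) ->
  (3 %| #|H'|)%N = (3 %| #|H|)%N.
Proof.
move=> HH' H'H.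
apply/idP/idP => /(Cauchy (isT : prime 3))[g gH o3]; rewrite -o3 order_dvdG //.
  by have [h hH /twisted_by_square e] := HH' g gH; rewrite (order3_pow4 o3) e !groupM.
by have [h hH /twisted_by_square e] := H'H g gH; rewrite (order3_pow4 o3) -e !groupM.
Qed.

Lemma num_twist_imagesE l : num_twist_images iota E l
  = #|[set (L :^: [set: GL2 l])%g | L : {group GL2 l} & `[< twist_image iota E L >]]|.
Proof. by []. Qed.

Lemma num_twist_images_2 : (num_twist_images iota E 2 <= 2)%N.
Proof.
rewrite num_twist_imagesE; set X := [set _ | _ in _].
have [-> | [C /imsetP[L0 L0X _]]] := set_0Vmem X; first by rewrite cards0.
move: L0X; rewrite inE => /asboolP.
case/(twist_image_matrices (isT : prime 2) c2 c3) => [H [_ [HE _ _ _]]].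
apply: (@card_classes_2 _ (3 %| #|H|)%N) => L /asboolP.
case/(twist_image_matrices (isT : prime 2) c2 c3) => [H' [J [HE' _ HL LH]]].
rewrite (dvd3_twist HL LH).
by have [x ->] := galois_image_conj (isT : prime 2) HE' HE; rewrite cardJg.
Qed.

Lemma num_twist_images_odd l : prime l -> l != 2%N ->
  let n := num_twist_images iota E l in
  [/\ (n <= 3)%N,
      n = 3%N -> forall G : {group GL2 l}, galois_image iota E G -> in_borel G &
      n = 2%N -> forall G : {group GL2 l}, galois_image iota E G ->
        in_borel G \/ in_normalizer_of_cartan G].
Proof.
move=> l_pr l_odd n; rewrite {}/n num_twist_imagesE; set X := [set _ | _ in _].
have [-> | [C /imsetP[L0 L0X _]]] := set_0Vmem X; first by rewrite cards0.
move: L0X; rewrite inE => /asboolP.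
case/(twist_image_matrices l_pr c2 c3) => [H [_ [HE _ _ _]]].
have [|n3 nb nc] := @card_classes_odd l l_pr (fun L => `[< twist_image iota E L >]) H l_odd.
  move=> L /asboolP/(twist_image_matrices l_pr c2 c3)[H' [J [HE' Jn HL LH]]].
  have [x ->] := pm_twist l_pr l_odd Jn HL LH.
  have [y ->] := galois_image_conj l_pr HE' HE.
  by exists (y * x)%g; rewrite pmJ -conjsgM.
have sG (G : {group GL2 l}) : galois_image iota E G -> exists x, G \subset (pm H :^ x)%g.
  move=> /(galois_image_conj l_pr)/(_ HE)[x ->]; exists x.
  by rewrite conjSg sub_pm.
split=> // [/nb[v sv] G | /nc bc G] /sG[x sGx].
  exact: in_borelS sGx (in_borelJ x (stable_line_borel sv)).
case: bc => bc; [left | right].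
  exact: in_borelS sGx (in_borelJ x bc).
exact: in_normalizer_of_cartanS sGx (in_normalizer_of_cartanJ x bc).
Qed.

End Main.

Theorem lemma5p27 (K : fieldExtType rat) (Kbar : closedFieldType)
    (iota : {rmorphism K -> Kbar}) (HKbar : algebraic_closure iota)
    (E : elliptic_curve K) (l : nat) (Hl : prime l) :
  let n := num_twist_images iota E l in
  [/\ (n <= 3)%N,
      n = 3%N -> forall G : {group {'GL_2(l)}},
        galois_image iota E G -> in_borel G &
      n = 2%N -> forall G : {group {'GL_2(l)}},
        galois_image iota E G -> in_borel G \/ in_normalizer_of_cartan G].
Proof.
have natn n : n.+1%:R != 0 :> Kbar.
  rewrite -(rmorph_nat iota) -(rmorph_nat (in_alg K)) !fmorph_eq0.
  by rewrite Num.Theory.pnatr_eq0.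
have [l2|l_odd] := eqVneq l 2%N; last first.
  have odd_l := num_twist_images_odd iota E (natn 1%N) (natn 2%N) Hl l_odd.
  exact: odd_l.
subst l; move=> n; have n2 : (n <= 2)%N by apply: num_twist_images_2; apply: natn.
split=> [|n3|_ G _]; first exact: leq_trans n2 _.
  by move: n2; rewrite n3.
(* The trivial group, whose normalizer is everything, is the split Cartan group. *)
right; exists 1%g; first by left.
by rewrite norm1 subsetT.
Qed.
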